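(* Let $(X,c)$ be a Čech closure space, let $\mathcal{U}=\{U^\alpha\}_{\alpha\in A}$ be an interior cover of $(X,c)$, and let $X_0\subset X$. For $\nu=(\nu_1,\dots,\nu_n)\in A^n$ put $U^\nu=\bigcap_{i=1}^n U^{\nu_i}$ and $U^\nu_0=X_0\cap U^\nu$. Consider the diagram of groupoids $$\bigsqcup_{\nu\in A^2}\Pi(U^\nu,U^\nu_0)\ \overset{a}{\underset{b}{\rightrightarrows}}\ \bigsqcup_{\alpha\in A}\Pi(U^\alpha,U^\alpha_0)\ \xrightarrow{\ c\ }\ \Pi(X,X_0),$$ where $a$ and $b$ are the functors determined by the inclusions $a_\nu:U^{\nu_1}\cap U^{\nu_2}\to U^{\nu_1}$ and $b_\nu:U^{\nu_1}\cap U^{\nu_2}\to U^{\nu_2}$ ($\nu=(\nu_1,\nu_2)\in A^2$), and $c$ is the functor determined by the inclusions $U^\alpha\to X$. If $X_0$ meets each path-component of every two-fold and every three-fold intersection of distinct sets in $\mathcal{U}$, then $c$ is the coequalizer of $a,b$ in the category of groupoids.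
   Context: A Čech closure space $(X,c)$ is a set $X$ with a map $c:\mathcal{P}(X)\to\mathcal{P}(X)$ such that $c(\emptyset)=\emptyset$, $A\subseteq c(A)$, and $c(A\cup B)=c(A)\cup c(B)$; it is not assumed that $c^2=c$. A topological space is a closure space via its topological closure. A map $f:(X,c_X)\to(Y,c_Y)$ is continuous iff $f(c_X(A))\subseteq c_Y(f(A))$ for all $A\subseteq X$. $U$ is a neighborhood of $x$ if $x\in X\setminus c(X\setminus U)$. An interior cover of $(X,c)$ is a family of subsets such that every point $x\in X$ has a neighborhood belonging to the family. A subset $A\subseteq X$ carries the subspace closure $c_A(B)=A\cap c(B)$. The product closure structure on $X\times Y$ is the one in which, at each point $(x,y)$, the sets $V\times W$ ($V$ a neighborhood of $x$, $W$ a neighborhood of $y$) form a local base of neighborhoods. $I=[0,1]$ has its usual topology. The fundamental groupoid $\Pi(X,c)$ has the points of $X$ as objects and, as morphisms from $x$ to $y$, homotopy classes rel $\partial I$ of continuous maps (paths) $v:I\to(X,c)$ with $v(0)=x$, $v(1)=y$ (homotopies are continuous maps $I\times I\to(X,c)$ fixed on $\partial I$); composition is $[w]\circ[v]=[v\star w]$, where $v\star w$ is the concatenation ''first $v$, then $w$''. For $A\subset X$, $\Pi(X,A)$ is the full subgroupoid on the objects in $A$. Each $U^\nu$ is regarded as a closure space with the subspace closure; path components are taken with respect to continuous paths from $I$. *)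

(* Defs.v *)
From HB Require Import structures.
From mathcomp Require Import all_boot all_order all_algebra.
From mathcomp Require Import ring lra.
From mathcomp Require Import mathcomp_extra boolp classical_sets functions.
From mathcomp Require Import set_interval reals topology normedtype.
From mathcomp Require Import generic_quotient.

Set Implicit Arguments.
Unset Strict Implicit.
Unset Printing Implicit Defensive.

Import Order.TTheory GRing.Theory Num.Theory.
Import numFieldNormedType.Exports.

Local Open Scope classical_set_scope.
Local Open Scope ring_scope.
Local Open Scope quotient_scope.

Record closureSpace := ClosureSpace {
  cs_carrier :> Type;
  cl : set cs_carrier -> set cs_carrier;
  cl0 : cl set0 = set0;
  sub_cl : forall A, A `<=` cl A;
  clU : forall A B, cl (A `|` B) = cl A `|` cl B
}.

Definition cs_nbhs (X : closureSpace) (x : X) (U : set X) : Prop :=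
  (~` cl (~` U)) x.

Definition interior_cover (X : closureSpace) (A : Type) (U : A -> set X) :
  Prop := forall x : X, exists a, cs_nbhs x (U a).

Definition cs_continuous (X Y : closureSpace) (f : X -> Y) : Prop :=
  forall A : set X, f @` cl A `<=` cl (f @` A).

Record cs_map (X Y : closureSpace) := CsMap {
  cs_fun :> X -> Y;
  cs_fun_continuous : cs_continuous cs_fun
}.

Section closure_space_theory.

Lemma clS (X : closureSpace) (A B : set X) : A `<=` B -> cl A `<=` cl B.
Proof. by move=> /setUidr <-; rewrite clU; apply: subsetUl. Qed.

Lemma cs_nbhsT (X : closureSpace) (x : X) : cs_nbhs x setT.
Proof. by rewrite /cs_nbhs setCT cl0. Qed.

Lemma cs_nbhsI (X : closureSpace) (x : X) (U V : set X) :
  cs_nbhs x U -> cs_nbhs x V -> cs_nbhs x (U `&` V).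
Proof. by rewrite /cs_nbhs setCI clU => ? ? []. Qed.

Lemma cs_nbhsS (X : closureSpace) (x : X) (U V : set X) :
  U `<=` V -> cs_nbhs x U -> cs_nbhs x V.
Proof. by move=> UV nU /(clS (subsetC UV)). Qed.

Lemma cs_nbhs_mem (X : closureSpace) (x : X) (U : set X) : cs_nbhs x U -> U x.
Proof. by move=> nU; apply: contrapT => Ux; apply: nU; apply: sub_cl. Qed.

Lemma clP (X : closureSpace) (x : X) (A : set X) :
  cl A x <-> forall U, cs_nbhs x U -> (U `&` A) !=set0.
Proof.
split=> [cAx U nU|nA].
  apply: contrapT => UA; apply: nU; apply: clS cAx => y Ay Uy.
  by apply: UA; exists y.
apply: contrapT => cAx; have [|y []//] := nA (~` A).
by rewrite /cs_nbhs setCK.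
Qed.

Lemma cs_continuous_nbhs (X Y : closureSpace) (f : X -> Y) (x : X) U :
  cs_continuous f -> cs_nbhs (f x) U -> cs_nbhs x (f @^-1` U).
Proof.
move=> cf nU cx; apply: nU.
by apply: clS (cf (~` (f @^-1` U)) _ (ex_intro2 _ _ x cx erefl)) => _ [z ? <-].
Qed.

Lemma cs_continuous_comp (X Y Z : closureSpace) (g : Y -> Z) (f : X -> Y) :
  cs_continuous g -> cs_continuous f -> cs_continuous (g \o f).
Proof.
move=> cg cf A _ [x cx <-]; rewrite -image_comp.
by apply: cg; exists (f x) => //; apply: cf; exists x.
Qed.

Lemma cs_continuous_id (X : closureSpace) : cs_continuous (@idfun X).
Proof. by move=> A _ [x ? <-]; rewrite image_id. Qed.

Lemma cs_continuous_cst (X Y : closureSpace) (y : Y) :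
  cs_continuous (fun _ : X => y).
Proof.
move=> A _ [x cx <-]; apply: sub_cl.
have [z [_ Az]] := (clP x A).1 cx setT (@cs_nbhsT X x).
by exists z.
Qed.

End closure_space_theory.

Definition top_cs (T : topologicalType) : closureSpace :=
  @ClosureSpace T closure (@closure0 T) (@subset_closure T) (@closureU T).

(** Subspaces; the carrier is the sigma type [set_type S], so that
   [c_S(B) = S `&` c(B)] becomes a preimage under the projection [set_val]. *)
Section subspace_cs.
Variables (X : closureSpace) (S : set X).

Definition scl (B : set S) : set S := set_val @^-1` cl (set_val @` B).

Lemma scl0 : scl set0 = set0.
Proof. by rewrite /scl image_set0 cl0. Qed.

Lemma sub_scl B : B `<=` scl B.
Proof. by move=> x Bx; apply: sub_cl; exists x. Qed.

Lemma sclU A B : scl (A `|` B) = scl A `|` scl B.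
Proof. by rewrite /scl image_setU clU. Qed.

Definition sub_cs : closureSpace := @ClosureSpace S scl scl0 sub_scl sclU.

End subspace_cs.

(** The product closure, as prescribed by the neighborhood base [V `*` W];
   see [prod_cs_nbhs]. *)
Section product_cs.
Variables (X Y : closureSpace).

Definition pcl (B : set (X * Y)) : set (X * Y) :=
  [set p | forall V W, cs_nbhs p.1 V -> cs_nbhs p.2 W ->
     (V `*` W) `&` B !=set0].

Lemma pcl0 : pcl set0 = set0.
Proof.
apply/seteqP; split=> // p /(_ setT setT (@cs_nbhsT X _) (@cs_nbhsT Y _)).
by rewrite setI0 => -[].
Qed.

Lemma sub_pcl B : B `<=` pcl B.
Proof.
by move=> p Bp V W nV nW; exists p; split=> //; split; apply: cs_nbhs_mem.
Qed.

Lemma pclU A B : pcl (A `|` B) = pcl A `|` pcl B.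
Proof.
apply/seteqP; split=> [p pAB|p [pA|pB] V W nV nW]; last 2 first.
- by have [q [? ?]] := pA V W nV nW; exists q; split=> //; left.
- by have [q [? ?]] := pB V W nV nW; exists q; split=> //; right.
apply: contrapT => /not_orP[nA nB].
have {}nA : exists V W, [/\ cs_nbhs p.1 V, cs_nbhs p.2 W &
    ~ ((V `*` W) `&` A !=set0)].
  apply: contrapT => H; apply: nA => V W nV nW; apply: contrapT => ?.
  by apply: H; exists V, W.
have {}nB : exists V W, [/\ cs_nbhs p.1 V, cs_nbhs p.2 W &
    ~ ((V `*` W) `&` B !=set0)].
  apply: contrapT => H; apply: nB => V W nV nW; apply: contrapT => ?.
  by apply: H; exists V, W.
move: nA nB => [V [W [nV nW nA]]] [V' [W' [nV' nW' nB]]].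
have [q [[[V1 V2] [W1 W2]] [Aq|Bq]]] :=
  pAB _ _ (cs_nbhsI nV nV') (cs_nbhsI nW nW').
- by apply: nA; exists q.
- by apply: nB; exists q.
Qed.

Definition prod_cs : closureSpace :=
  @ClosureSpace (X * Y)%type pcl pcl0 sub_pcl pclU.

Lemma prod_cs_nbhs (p : prod_cs) (N : set prod_cs) :
  cs_nbhs p N <-> exists V W, [/\ cs_nbhs p.1 V, cs_nbhs p.2 W & V `*` W `<=` N].
Proof.
split=> [nN|[V [W [nV nW VWN]]] /(_ V W nV nW) [q [/VWN ? ?]]//].
apply: contrapT => H; apply: nN => V W nV nW; apply: contrapT => VW.
apply: H; exists V, W; split=> // q VWq; apply: contrapT => Nq.
by apply: VW; exists q.
Qed.

End product_cs.

Section continuity.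

Lemma top_cs_nbhs (T : topologicalType) (x : top_cs T) (U : set T) :
  @cs_nbhs (top_cs T) x U <-> nbhs x U.
Proof.
rewrite /cs_nbhs (_ : @cl (top_cs T) (~` U) = ~` interior U) ?setCK//.
exact: closure_setC.
Qed.

Lemma top_cs_continuous (S T : topologicalType) (f : S -> T) :
  continuous f -> @cs_continuous (top_cs S) (top_cs T) f.
Proof.
move=> cf A _ [x cx <-] B /cf fB; have [y [Ay By]] := cx _ fB.
by exists (f y); split=> //; exists y.
Qed.

Lemma prod_top_cs_continuous (S T Z : topologicalType) (f : S * T -> Z) :
  continuous f -> @cs_continuous (prod_cs (top_cs S) (top_cs T)) (top_cs Z) f.
Proof.
move=> cf A _ [p cp <-] B /cf [[/= V W] [nV nW] VWB].
have [||q [VWq Aq]] := cp V W; [exact/top_cs_nbhs|exact/top_cs_nbhs|].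
by exists (f q); split; [exists q|exact: VWB].
Qed.

Lemma cs_continuous_pair (P X Y : closureSpace) (f : P -> X) (g : P -> Y) :
  cs_continuous f -> cs_continuous g ->
  @cs_continuous P (prod_cs X Y) (fun p => (f p, g p)).
Proof.
move=> cf cg A _ [p cp <-] V W /(cs_continuous_nbhs cf) nV.
move=> /(cs_continuous_nbhs cg) nW.
have [q [[? ?] Aq]] := (clP p A).1 cp _ (cs_nbhsI nV nW).
by exists (f q, g q); split=> //; exists q.
Qed.

Lemma cs_continuous_paste (R : realType) (P X : closureSpace)
    (u : P -> top_cs R) (a : R) (f g : P -> X) :
  cs_continuous u -> cs_continuous f -> cs_continuous g ->
  (forall p, u p = a -> f p = g p) ->
  cs_continuous (fun p => if (u p : R) <= a then f p else g p).
Proof.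
move=> cu cf cg fg A _ [p cp <-].
set L := [set x : R | x <= a]; set G := [set x : R | a <= x].
have cL : closed L by exact: closed_le.
have cG : closed G by exact: closed_ge.
have : cl ((A `&` u @^-1` L) `|` (A `&` u @^-1` G)) p.
  apply: clS cp => q Aq; case: (leP (u q : R) a) => [uq|/ltW uq];
  by [left|right].
rewrite clU => -[] cp'.
- have Lp : (u p : R) <= a.
    apply: cL; apply: (@clS (top_cs R) _ _ _ _ (cu _ _ (ex_intro2 _ _ p cp' erefl))).
    by move=> _ [q [_ ?] <-].
  rewrite Lp; apply: clS (cf _ _ (ex_intro2 _ _ p cp' erefl)).
  by move=> _ [q [Aq Lq] <-]; exists q => //; rewrite ifT.
- have Gp : a <= (u p : R).
    apply: cG; apply: (@clS (top_cs R) _ _ _ _ (cu _ _ (ex_intro2 _ _ p cp' erefl))).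
    by move=> _ [q [_ ?] <-].
  rewrite (_ : (if _ then _ else _) = g p); last first.
    by case: ifPn => // pa; apply: fg; apply/eqP; rewrite eq_le pa.
  apply: clS (cg _ _ (ex_intro2 _ _ p cp' erefl)).
  move=> _ [q [Aq Gq] <-]; exists q => //; case: ifPn => // qa; apply: fg.
  by apply/eqP; rewrite eq_le qa.
Qed.

End continuity.

Section unit_interval.
Variable R : realType.

Definition unitI : topologicalType := set_type `[0 : R, 1]%classic.

Definition II : closureSpace := top_cs unitI.

Lemma toI_subproof (r : R) : Num.max 0 (Num.min r 1) \in `[0 : R, 1]%classic.
Proof.
by rewrite inE /= in_itv /= le_max lexx ge_max ler01 ge_min lexx orbT.
Qed.

Definition toI (r : R) : unitI := SigSub (toI_subproof r).

Lemma toIK (r : R) : 0 <= r <= 1 -> set_val (toI r) = r.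
Proof. by case/andP=> r0 r1; rewrite set_valE /= (min_idPl r1) (max_idPr r0). Qed.

Lemma unitI_itv (s : unitI) : 0 <= set_val s <= 1.
Proof. by have := set_valP s; rewrite /= in_itv. Qed.

Lemma valIK (s : unitI) : toI (set_val s) = s.
Proof. by apply: val_inj; rewrite -!set_valE toIK// unitI_itv. Qed.

Lemma valI_continuous : continuous (set_val : unitI -> R).
Proof. exact: initial_continuous. Qed.

Lemma toI_continuous : continuous toI.
Proof.
apply: continuous_comp_initial => r.
apply: (@continuous_max R R (cst 0) (idfun \min cst 1)).
  exact: cvg_cst.
by apply: continuous_min; [exact: cvg_id|exact: cvg_cst].
Qed.

Definition I0 : unitI := toI 0.
Definition I1 : unitI := toI 1.

Lemma valI0 : set_val I0 = 0. Proof. by rewrite toIK// lexx ler01. Qed.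
Lemma valI1 : set_val I1 = 1. Proof. by rewrite toIK// lexx ler01. Qed.

Lemma toI_comp (T : topologicalType) (u : T -> R) :
  continuous u -> continuous (toI \o u).
Proof. by move=> cu x; apply: continuous_comp; [exact: cu|exact: toI_continuous]. Qed.

Lemma II_continuous (u : R -> R) : continuous u ->
  @cs_continuous (II) (II) (fun s => toI (u (set_val s))).
Proof.
move=> cu; apply: (@top_cs_continuous unitI unitI).
apply: (@toI_comp unitI (u \o set_val)) => x.
by apply: continuous_comp; [exact: valI_continuous|exact: cu].
Qed.

Lemma valI_cs_continuous : @cs_continuous II (top_cs R) set_val.
Proof. exact: (top_cs_continuous valI_continuous). Qed.

Lemma fstI_cs_continuous : @cs_continuous (prod_cs II II) II fst.
Proof.
by apply: (@prod_top_cs_continuous unitI unitI unitI fst) => x; exact: cvg_fst.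
Qed.

Lemma sndI_cs_continuous : @cs_continuous (prod_cs II II) II snd.
Proof.
by apply: (@prod_top_cs_continuous unitI unitI unitI snd) => x; exact: cvg_snd.
Qed.

Lemma affine_continuous (a b : R) : continuous (fun s : R => a * s + b).
Proof.
move=> s; apply: (@cvgD _ R^o); last exact: cvg_cst.
by apply: cvgM; [exact: cvg_cst|exact: cvg_id].
Qed.

(** The map [s |-> a s + b], clamped to the interval. *)
Definition affI (a b : R) (s : II) : II := toI (a * set_val s + b).

Lemma affI_continuous (a b : R) : cs_continuous (affI a b).
Proof. exact: II_continuous (@affine_continuous a b). Qed.

Lemma affI_val (a b : R) (s : II) :
  0 <= a * set_val s + b <= 1 -> set_val (affI a b s) = a * set_val s + b.
Proof. exact: toIK. Qed.

Lemma affIE (a b : R) (s : II) (r : R) : a * set_val s + b = r -> affI a b s = toI r.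
Proof. by rewrite /affI => ->. Qed.

End unit_interval.
Arguments affI {R}.

Section paths.
Variables (R : realType) (X : closureSpace).
Local Notation I := (II R).
Local Notation "0I" := (I0 R).
Local Notation "1I" := (I1 R).

Record cpath (x y : X) := CPath {
  cpath_fun :> I -> X;
  cpath_continuous : cs_continuous cpath_fun;
  cpath0 : cpath_fun 0I = x;
  cpath1 : cpath_fun 1I = y
}.

Definition homotopic (x y : X) (v w : cpath x y) : Prop :=
  exists H : prod_cs I I -> X,
    [/\ cs_continuous H,
        forall s, H (s, 0I) = v s, forall s, H (s, 1I) = w s,
        forall t, H (0I, t) = x & forall t, H (1I, t) = y].

Definition cst_cpath (x : X) : cpath x x :=
  CPath (@cs_continuous_cst I X x) erefl erefl.

Lemma cs_continuous_aff (f : I -> X) (a b : R) :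
  cs_continuous f -> cs_continuous (fun s : I => f (affI a b s)).
Proof.
by move=> cf; apply: (cs_continuous_comp cf); exact: affI_continuous.
Qed.

(** The reversed path [s |-> v (1 - s)]. *)
Definition rev_fun (v : I -> X) (s : I) : X := v (affI (-1) 1 s).

Lemma rev_fun_continuous (v : I -> X) :
  cs_continuous v -> cs_continuous (rev_fun v).
Proof. exact: cs_continuous_aff. Qed.

Lemma rev_fun0 (v : I -> X) : rev_fun v 0I = v 1I.
Proof. by congr (v _); apply: affIE; rewrite valI0; ring. Qed.

Lemma rev_fun1 (v : I -> X) : rev_fun v 1I = v 0I.
Proof. by congr (v _); apply: affIE; rewrite valI1; ring. Qed.

Definition rev_cpath (x y : X) (v : cpath x y) : cpath y x :=
  CPath (@rev_fun_continuous v (@cpath_continuous _ _ v))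
    (etrans (rev_fun0 v) (cpath1 v)) (etrans (rev_fun1 v) (cpath0 v)).

(** The concatenation: [v (2 s)] if [s <= 1/2], and [w (2 s - 1)] otherwise. *)
Definition cat_fun (v w : I -> X) (s : I) : X :=
  if set_val s <= 2^-1 then v (affI 2 0 s) else w (affI 2 (-1) s).

Lemma cat_fun_continuous (v w : I -> X) :
  cs_continuous v -> cs_continuous w -> v 1I = w 0I ->
  cs_continuous (cat_fun v w).
Proof.
move=> cv cw vw; apply: (@cs_continuous_paste R I X set_val 2^-1).
- exact: valI_cs_continuous.
- exact: cs_continuous_aff.
- exact: cs_continuous_aff.
- move=> s es; rewrite (@affIE _ _ _ _ 1) ?(@affIE _ _ _ _ 0)//; rewrite es; lra.
Qed.

Lemma cat_fun0 (v w : I -> X) : cat_fun v w 0I = v 0I.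
Proof.
rewrite /cat_fun valI0 ifT; last by lra.
by congr (v _); apply: affIE; rewrite valI0; ring.
Qed.

Lemma cat_fun1 (v w : I -> X) : cat_fun v w 1I = w 1I.
Proof.
rewrite /cat_fun valI1 ifF; last by apply/negbTE; rewrite -ltNge; lra.
by congr (w _); apply: affIE; rewrite valI1; ring.
Qed.

Definition cat_cpath (x y z : X) (v : cpath x y) (w : cpath y z) : cpath x z :=
  CPath
    (@cat_fun_continuous v w (@cpath_continuous _ _ v) (@cpath_continuous _ _ w)
       (etrans (cpath1 v) (esym (cpath0 w))))
    (etrans (cat_fun0 v w) (cpath0 v)) (etrans (cat_fun1 v w) (cpath1 w)).

End paths.

Section homotopy_theory.
Variables (R : realType) (X : closureSpace).
Local Notation I := (II R).
Local Notation "0I" := (I0 R).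
Local Notation "1I" := (I1 R).

Lemma homotopic_refl (x y : X) (v : cpath R x y) : homotopic v v.
Proof.
exists (v \o fst); split=> //= [|_|_]; [|exact: cpath0|exact: cpath1].
exact: (@cs_continuous_comp (prod_cs I I) I X v fst (@cpath_continuous _ _ _ _ v)
  (@fstI_cs_continuous R)).
Qed.

Lemma affI_snd_continuous (a b : R) :
  @cs_continuous (prod_cs I I) (prod_cs I I) (fun p => (p.1, affI a b p.2)).
Proof.
apply: cs_continuous_pair; first exact: fstI_cs_continuous.
exact: (cs_continuous_comp (@affI_continuous R a b) (@sndI_cs_continuous R)).
Qed.

Lemma affI_fst_continuous (a b : R) :
  @cs_continuous (prod_cs I I) (prod_cs I I) (fun p => (affI a b p.1, p.2)).
Proof.
apply: cs_continuous_pair; last exact: sndI_cs_continuous.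
exact: (cs_continuous_comp (@affI_continuous R a b) (@fstI_cs_continuous R)).
Qed.

Lemma homotopic_sym (x y : X) (v w : cpath R x y) :
  homotopic v w -> homotopic w v.
Proof.
move=> [H [cH H0 H1 Hx Hy]]; exists (fun p => H (p.1, affI (-1) 1 p.2)).
split=> //= [|s|s].
- exact: (cs_continuous_comp cH (@affI_snd_continuous _ _)).
- by rewrite -H1 (@affIE _ _ _ _ 1)// valI0; ring.
- by rewrite -H0 (@affIE _ _ _ _ 0)// valI1; ring.
Qed.

Lemma homotopic_trans (x y : X) (v w u : cpath R x y) :
  homotopic v w -> homotopic w u -> homotopic v u.
Proof.
move=> [H [cH H0 H1 Hx Hy]] [K [cK K0 K1 Kx Ky]].
exists (fun p : prod_cs I I => if (set_val p.2 : R) <= 2^-1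
  then H (p.1, affI 2 0 p.2) else K (p.1, affI 2 (-1) p.2)).
split=> /= [|s|s|t|t]; last 2 first.
- by case: ifP.
- by case: ifP.
- apply: (@cs_continuous_paste R (prod_cs I I) X (fun p => set_val p.2) 2^-1
      (fun p => H (p.1, affI 2 0 p.2)) (fun p => K (p.1, affI 2 (-1) p.2))).
  + exact: (cs_continuous_comp (@valI_cs_continuous R) (@sndI_cs_continuous R)).
  + exact: (cs_continuous_comp cH (@affI_snd_continuous _ _)).
  + exact: (cs_continuous_comp cK (@affI_snd_continuous _ _)).
  + move=> p es; rewrite (@affIE _ _ _ _ 1) ?(@affIE _ _ _ _ 0) ?H1 ?K0//;
    rewrite es; lra.
- rewrite valI0 ifT; last by lra.
  by rewrite (@affIE _ _ _ _ 0) ?H0// valI0; ring.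
- rewrite valI1 ifF; last by apply/negbTE; rewrite -ltNge; lra.
  by rewrite (@affIE _ _ _ _ 1) ?K1// valI1; ring.
Qed.

Lemma homotopic_cat (x y z : X) (v v' : cpath R x y) (w w' : cpath R y z) :
  homotopic v v' -> homotopic w w' ->
  homotopic (cat_cpath v w) (cat_cpath v' w').
Proof.
move=> [H [cH H0 H1 Hx Hy]] [K [cK K0 K1 Kx Ky]].
exists (fun p : prod_cs I I => if (set_val p.1 : R) <= 2^-1
  then H (affI 2 0 p.1, p.2) else K (affI 2 (-1) p.1, p.2)).
split=> /= [|s|s|t|t].
- apply: (@cs_continuous_paste R (prod_cs I I) X (fun p => set_val p.1) 2^-1
      (fun p => H (affI 2 0 p.1, p.2)) (fun p => K (affI 2 (-1) p.1, p.2))).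
  + exact: (cs_continuous_comp (@valI_cs_continuous R) (@fstI_cs_continuous R)).
  + exact: (cs_continuous_comp cH (@affI_fst_continuous _ _)).
  + exact: (cs_continuous_comp cK (@affI_fst_continuous _ _)).
  + move=> p es; rewrite (@affIE _ _ _ _ 1) ?(@affIE _ _ _ _ 0) ?Hy ?Kx//;
    rewrite es; lra.
- by rewrite /cat_fun H0 K0.
- by rewrite /cat_fun H1 K1.
- rewrite valI0 ifT; last by lra.
  by rewrite (@affIE _ _ _ _ 0) ?Hx// valI0; ring.
- rewrite valI1 ifF; last by apply/negbTE; rewrite -ltNge; lra.
  by rewrite (@affIE _ _ _ _ 1) ?Ky// valI1; ring.
Qed.

Lemma homotopic_reparam (x y x' y' : X) (v : cpath R x' y') (p q : cpath R x y)
    (f g : unitI R -> unitI R) :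
  continuous f -> continuous g -> f 0I = g 0I -> f 1I = g 1I ->
  (forall s, p s = v (f s)) -> (forall s, q s = v (g s)) ->
  homotopic p q.
Proof.
move=> cf cg fg0 fg1 pf qg.
pose K (r : unitI R * unitI R) : unitI R :=
  toI ((1 - set_val r.2) * set_val (f r.1) + set_val r.2 * set_val (g r.1)).
have cval (h : unitI R * unitI R -> unitI R) :
  continuous h -> continuous (fun r => set_val (h r) : R).
  move=> ch r; apply: continuous_comp; [exact: ch|exact: valI_continuous].
have c1 (h : unitI R -> unitI R) :
  continuous h -> continuous (fun r : unitI R * unitI R => h r.1).
  move=> ch r; apply: continuous_comp; [exact: cvg_fst|exact: ch].
have c2 : continuous (fun r : unitI R * unitI R => r.2).
  by move=> r; exact: cvg_snd.
have cK : continuous K.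
  apply: toI_comp => r; apply: (@cvgD _ R^o).
    apply: cvgM; last exact/cval/c1.
    by apply: (@cvgB _ R^o); [exact: cvg_cst|exact: cval].
  by apply: cvgM; [exact: cval|exact/cval/c1].
exists (v \o K); split=> /= [|s|s|t|t].
- exact: (@cs_continuous_comp (prod_cs I I) I X v K
    (@cpath_continuous _ _ _ _ v) (prod_top_cs_continuous cK)).
- by rewrite pf /K /= valI0 subr0 mul0r mul1r addr0 valIK.
- by rewrite qg /K /= valI1 subrr mul0r mul1r add0r valIK.
- by rewrite /K /= -fg0 -mulrDl subrK mul1r valIK -pf cpath0.
- by rewrite /K /= -fg1 -mulrDl subrK mul1r valIK -pf cpath1.
Qed.

Lemma homotopic_catA (x y z t : X) (u : cpath R x y) (v : cpath R y z)
    (w : cpath R z t) :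
  homotopic (cat_cpath u (cat_cpath v w)) (cat_cpath (cat_cpath u v) w).
Proof.
pose h (s : R) := Num.max (2^-1 * s) (Num.max (s - 4^-1) (2 * s - 1)).
have ch : continuous h.
  move=> s; apply: (@continuous_max R R (fun s => 2^-1 * s)
    ((fun s => s - 4^-1) \max (fun s => 2 * s - 1))).
    by apply: cvgM; [exact: cvg_cst|exact: cvg_id].
  apply: continuous_max.
    by apply: (@cvgB _ R^o); [exact: cvg_id|exact: cvg_cst].
  exact: affine_continuous.
apply: (@homotopic_reparam x t x t (cat_cpath (cat_cpath u v) w) _ _
  (fun s => toI (h (set_val s))) id).
- apply: (@toI_comp _ _ (h \o set_val)) => s.
  by apply: continuous_comp; [exact: valI_continuous|exact: ch].
- by move=> ?; exact: cvg_id.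
- congr toI; rewrite valI0 /h mulr0 mulr0 !add0r.
  by rewrite [X in Num.max _ X]max_l ?max_l//; lra.
- congr toI; rewrite valI1 /h.
  by rewrite [X in Num.max _ X]max_r ?max_r//; lra.
2: by [].
move=> s; have /andP[s0 s1] := unitI_itv s; move: s0 s1.
set r : R := set_val s => r0 r1.
have hE : set_val (toI (h r)) = h r.
  by rewrite toIK// /h !le_max !ge_max; apply/andP; split; [apply/orP; left; lra|lra].
rewrite /=; case: (leP r 2^-1) => r2.
  have e : h r = 2^-1 * r.
    by rewrite /h [X in Num.max _ X]max_l ?max_l//; lra.
  rewrite e in hE *.
  have e2 : affI 2 0 (toI (2^-1 * r)) = s.
    by rewrite -[RHS]valIK; apply: affIE; rewrite hE -/r; lra.
  rewrite [RHS]/cat_fun hE ifT; last by lra.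
  by rewrite e2 /cat_fun -/r r2.
rewrite [LHS]/cat_fun -/r ifF; last by apply/negbTE; rewrite -ltNge.
have e1 : set_val (affI 2 (-1) s) = 2 * r - 1 by rewrite affI_val -/r; lra.
case: (leP r (3%:R / 4%:R)) => r3.
  have e : h r = r - 4^-1.
    by rewrite /h [X in Num.max _ X]max_l ?max_r//; lra.
  rewrite e in hE *.
  rewrite [RHS]/cat_fun hE ifT; last by lra.
  have e2 : set_val (affI 2 0 (toI (r - 4^-1))) = 2 * r - 2^-1.
    by rewrite affI_val hE; lra.
  rewrite /cat_fun e2 e1 ifT ?ifF; last first.
  - by lra.
  - by apply/negbTE; rewrite -ltNge; lra.
  by congr (v _); rewrite /affI e2 e1; congr toI; lra.
have e : h r = 2 * r - 1.
  by rewrite /h [X in Num.max _ X]max_r ?max_r//; lra.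
rewrite e in hE *.
rewrite /cat_fun e1 !ifF; last first.
- by apply/negbTE; rewrite -ltNge; lra.
- by apply/negbTE; rewrite -ltNge; lra.
by [].
Qed.

Lemma homotopic_cat1 (x y : X) (v : cpath R x y) :
  homotopic (cat_cpath v (cst_cpath R y)) v.
Proof.
pose h (s : R) := Num.min (2 * s) 1.
apply: (@homotopic_reparam x y x y v _ _ (fun s => toI (h (set_val s))) id).
- apply: (@toI_comp _ _ (h \o set_val)) => s.
  apply: continuous_comp; [exact: valI_continuous|].
  apply: (@continuous_min R R (fun s => 2 * s) (cst 1)); last exact: cvg_cst.
  by apply: cvgM; [exact: cvg_cst|exact: cvg_id].
- by move=> ?; exact: cvg_id.
- by congr toI; rewrite valI0 /h mulr0 min_l.
- by congr toI; rewrite valI1 /h min_r//; lra.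
2: by [].
move=> s; rewrite /= /cat_fun /h; case: leP => s2.
  by congr (v _); apply: affIE; rewrite min_l; lra.
rewrite min_r; last by lra.
by rewrite -[LHS](cpath1 v).
Qed.

Lemma homotopic_1cat (x y : X) (v : cpath R x y) :
  homotopic (cat_cpath (cst_cpath R x) v) v.
Proof.
pose h (s : R) := Num.max (2 * s - 1) 0.
apply: (@homotopic_reparam x y x y v _ _ (fun s => toI (h (set_val s))) id).
- apply: (@toI_comp _ _ (h \o set_val)) => s.
  apply: continuous_comp; [exact: valI_continuous|].
  apply: (@continuous_max R R (fun s => 2 * s - 1) (cst 0)); last exact: cvg_cst.
  exact: affine_continuous.
- by move=> ?; exact: cvg_id.
- by congr toI; rewrite valI0 /h mulr0 max_r//; lra.
- by congr toI; rewrite valI1 /h max_l//; lra.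
2: by [].
move=> s; rewrite /= /cat_fun /h; case: leP => s2.
  rewrite max_r; last by lra.
  by rewrite -[LHS](cpath0 v).
by congr (v _); apply: affIE; rewrite max_l; lra.
Qed.

Lemma homotopic_catV (x y : X) (v : cpath R x y) :
  homotopic (cat_cpath v (rev_cpath v)) (cst_cpath R x).
Proof.
pose h (s : R) := Num.min (2 * s) (- 2 * s + 2).
apply: (@homotopic_reparam x x x y v _ _ (fun s => toI (h (set_val s)))
  (fun=> 0I)).
- apply: (@toI_comp _ _ (h \o set_val)) => s.
  apply: continuous_comp; [exact: valI_continuous|].
  apply: (@continuous_min R R (fun s => 2 * s)); last exact: affine_continuous.
  by apply: cvgM; [exact: cvg_cst|exact: cvg_id].
- exact: cst_continuous.
- rewrite -[RHS]/(toI 0); apply: congr1; rewrite valI0 /h min_l; lra.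
- rewrite -[RHS]/(toI 0); apply: congr1; rewrite valI1 /h min_r; lra.
2: by move=> s; rewrite cpath0.
move=> s; rewrite /= /cat_fun /rev_fun /h; case: leP => s2.
  by congr (v _); apply: affIE; rewrite min_l; lra.
have /andP[s0 s1] := unitI_itv s.
by congr (v _); apply: affIE; rewrite affI_val ?min_r; lra.
Qed.

Lemma homotopic_Vcat (x y : X) (v : cpath R x y) :
  homotopic (cat_cpath (rev_cpath v) v) (cst_cpath R y).
Proof.
pose h (s : R) := Num.max (1 - 2 * s) (2 * s - 1).
apply: (@homotopic_reparam y y x y v _ _ (fun s => toI (h (set_val s)))
  (fun=> 1I)).
- apply: (@toI_comp _ _ (h \o set_val)) => s.
  apply: continuous_comp; [exact: valI_continuous|].
  apply: (@continuous_max R R (fun s => 1 - 2 * s)); last exact: affine_continuous.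
  apply: (@cvgB _ R^o); first exact: cvg_cst.
  by apply: cvgM; [exact: cvg_cst|exact: cvg_id].
- exact: cst_continuous.
- rewrite -[RHS]/(toI 1); apply: congr1; rewrite valI0 /h max_l; lra.
- rewrite -[RHS]/(toI 1); apply: congr1; rewrite valI1 /h max_r; lra.
2: by move=> s; rewrite cpath1.
move=> s; have /andP[s0 s1] := unitI_itv s.
rewrite /= /cat_fun /rev_fun /h; case: leP => s2.
  by congr (v _); apply: affIE; rewrite affI_val ?max_l; lra.
by congr (v _); apply: affIE; rewrite max_r; lra.
Qed.

Lemma homotopic_rev (x y : X) (v w : cpath R x y) :
  homotopic v w -> homotopic (rev_cpath v) (rev_cpath w).
Proof.
move=> [H [cH H0 H1 Hx Hy]]; exists (fun p => H (affI (-1) 1 p.1, p.2)).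
split=> /= [|s|s|t|t].
- exact: (cs_continuous_comp cH (@affI_fst_continuous _ _)).
- by rewrite H0.
- by rewrite H1.
- by rewrite (@affIE _ _ _ _ 1) ?Hy// valI0; ring.
- by rewrite (@affIE _ _ _ _ 0) ?Hx// valI1; ring.
Qed.

End homotopy_theory.

Section map_cpath.
Variables (R : realType) (X Y : closureSpace) (f : cs_map X Y).

Definition map_cpath (x y : X) (v : cpath R x y) : cpath R (f x) (f y) :=
  @CPath R Y (f x) (f y) (f \o v)
    (@cs_continuous_comp _ _ _ _ _ (@cs_fun_continuous _ _ f)
       (@cpath_continuous _ _ _ _ v))
    (congr1 f (cpath0 v)) (congr1 f (cpath1 v)).

Lemma homotopic_map (x y : X) (v w : cpath R x y) :
  homotopic v w -> homotopic (map_cpath v) (map_cpath w).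
Proof.
move=> [H [cH H0 H1 Hx Hy]]; exists (f \o H); split=> /= [|s|s|t|t].
- exact: (@cs_continuous_comp _ _ _ _ _ (@cs_fun_continuous _ _ f) cH).
- by rewrite H0.
- by rewrite H1.
- by rewrite Hx.
- by rewrite Hy.
Qed.

Lemma eq_homotopic (Z : closureSpace) (x y : Z) (v w : cpath R x y) :
  (forall s, v s = w s) -> homotopic v w.
Proof.
move=> vw; apply: (@homotopic_reparam R Z x y x y v _ _ id id) => //;
by move=> s; exact: cvg_id.
Qed.

Lemma map_cat_cpath (x y z : X) (v : cpath R x y) (w : cpath R y z) :
  homotopic (map_cpath (cat_cpath v w)) (cat_cpath (map_cpath v) (map_cpath w)).
Proof. by apply: eq_homotopic => s; rewrite /= /cat_fun /=; case: ifP. Qed.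

Lemma map_cst_cpath (x : X) :
  homotopic (map_cpath (cst_cpath R x)) (cst_cpath R (f x)).
Proof. exact: eq_homotopic. Qed.

End map_cpath.

(** [gcomp g f] is the composite "[g] after [f]". *)
Record groupoid := Groupoid {
  gobj :> Type;
  hom : gobj -> gobj -> Type;
  gid : forall x, hom x x;
  gcomp : forall x y z, hom y z -> hom x y -> hom x z;
  ginv : forall x y, hom x y -> hom y x;
  gcompA : forall x y z t (h : hom z t) (g : hom y z) (f : hom x y),
    gcomp h (gcomp g f) = gcomp (gcomp h g) f;
  gcomp1f : forall x y (f : hom x y), gcomp (gid y) f = f;
  gcompf1 : forall x y (f : hom x y), gcomp f (gid x) = f;
  gcompVf : forall x y (f : hom x y), gcomp (ginv f) f = gid x;
  gcompfV : forall x y (f : hom x y), gcomp f (ginv f) = gid y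
}.

Record functor (G H : groupoid) := Functor {
  fobj :> G -> H;
  fhom : forall x y, hom x y -> hom (fobj x) (fobj y);
  fhom1 : forall x, fhom (gid x) = gid (fobj x);
  fhomM : forall x y z (g : hom y z) (f : hom x y),
    fhom (gcomp g f) = gcomp (fhom g) (fhom f)
}.

Section functor_comp.
Variables (G H K : groupoid) (F' : functor H K) (F : functor G H).

Definition fcomp_hom (x y : G) (f : hom x y) : hom (F' (F x)) (F' (F y)) :=
  fhom F' (fhom F f).

Lemma fcomp_hom1 x : fcomp_hom (gid x) = gid (F' (F x)).
Proof. by rewrite /fcomp_hom !fhom1. Qed.

Lemma fcomp_homM x y z (g : hom y z) (f : hom x y) :
  fcomp_hom (gcomp g f) = gcomp (fcomp_hom g) (fcomp_hom f).
Proof. by rewrite /fcomp_hom !fhomM. Qed.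

Definition fcomp : functor G K := Functor fcomp_hom1 fcomp_homM.

End functor_comp.

Definition is_coequalizer (G H K : groupoid) (a b : functor G H)
    (c : functor H K) : Prop :=
  fcomp c a = fcomp c b /\
  forall (L : groupoid) (F : functor H L), fcomp F a = fcomp F b ->
    exists! F' : functor K L, fcomp F' c = F.

Section full_subgroupoid.

Definition full_subgroupoid (G : groupoid) (B : set G) : groupoid :=
  @Groupoid B (fun x y => hom (set_val x) (set_val y))
    (fun x => gid (set_val x))
    (fun x y z => @gcomp G (set_val x) (set_val y) (set_val z))
    (fun x y => @ginv G (set_val x) (set_val y))
    (fun x y z t => @gcompA G (set_val x) (set_val y) (set_val z) (set_val t))
    (fun x y => @gcomp1f G (set_val x) (set_val y))
    (fun x y => @gcompf1 G (set_val x) (set_val y))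
    (fun x y => @gcompVf G (set_val x) (set_val y))
    (fun x y => @gcompfV G (set_val x) (set_val y)).

Variables (G H : groupoid) (F : functor G H) (B : set G) (C : set H).
Hypothesis BC : forall x, B x -> C (F x).

Definition full_functor : functor (full_subgroupoid B) (full_subgroupoid C) :=
  @Functor (full_subgroupoid B) (full_subgroupoid C)
    (fun x => SigSub (mem_set (BC (set_valP x))))
    (fun x y => @fhom G H F (set_val x) (set_val y))
    (fun x => fhom1 F (set_val x))
    (fun x y z => @fhomM G H F (set_val x) (set_val y) (set_val z)).

End full_subgroupoid.

Section coproduct.
Variables (J : Type) (G : J -> groupoid).

(** A morphism [(i, x) -> (j, y)] exists only if [i = j], and is then a morphism
   of [G j]. *)
Definition coprod_hom (p q : {j : J & G j}) : Type :=
  {e : projT1 p = projT1 q & hom (eq_rect _ G (projT2 p) _ e) (projT2 q)}.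

Definition coprod_id (p : {j : J & G j}) : coprod_hom p p :=
  existT _ erefl (gid (projT2 p)).

Definition coprod_comp (p q r : {j : J & G j}) :
  coprod_hom q r -> coprod_hom p q -> coprod_hom p r.
Proof.
case: p q r => [i x] [j y] [k z] [/= ejk g] [/= eij f].
case: k / ejk z g => z g; case: j / eij y z f g => y z f g.
by exists erefl; exact: gcomp g f.
Defined.

Definition coprod_inv (p q : {j : J & G j}) : coprod_hom p q -> coprod_hom q p.
Proof.
case: p q => [i x] [j y] [/= eij f].
by case: j / eij y f => y f; exists erefl; exact: ginv f.
Defined.

Lemma coprod_compA p q r s (h : coprod_hom r s) (g : coprod_hom q r)
    (f : coprod_hom p q) :
  coprod_comp h (coprod_comp g f) = coprod_comp (coprod_comp h g) f.
Proof.
case: p q r s h g f => [i x] [j y] [k z] [l t] [/= ekl h] [/= ejk g] [/= eij f].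
case: l / ekl t h => t h; case: k / ejk z t g h => z t g h.
by case: j / eij y z t f g h => y z t f g h /=; rewrite gcompA.
Qed.

Lemma coprod_comp1f p q (f : coprod_hom p q) : coprod_comp (coprod_id q) f = f.
Proof.
case: p q f => [i x] [j y] [/= eij f].
by case: j / eij y f => y f /=; rewrite gcomp1f.
Qed.

Lemma coprod_compf1 p q (f : coprod_hom p q) : coprod_comp f (coprod_id p) = f.
Proof.
case: p q f => [i x] [j y] [/= eij f].
by case: j / eij y f => y f /=; rewrite gcompf1.
Qed.

Lemma coprod_compVf p q (f : coprod_hom p q) :
  coprod_comp (coprod_inv f) f = coprod_id p.
Proof.
case: p q f => [i x] [j y] [/= eij f].
by case: j / eij y f => y f /=; rewrite gcompVf.
Qed.

Lemma coprod_compfV p q (f : coprod_hom p q) :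
  coprod_comp f (coprod_inv f) = coprod_id q.
Proof.
case: p q f => [i x] [j y] [/= eij f].
by case: j / eij y f => y f /=; rewrite gcompfV.
Qed.

Definition coproduct : groupoid :=
  Groupoid coprod_compA coprod_comp1f coprod_compf1 coprod_compVf coprod_compfV.

Definition coproj (j : J) : functor (G j) coproduct :=
  @Functor (G j) coproduct (existT _ j) (fun x y f => existT _ erefl f)
    (fun=> erefl) (fun _ _ _ _ _ => erefl).

Variables (H : groupoid) (F : forall j, functor (G j) H).

Definition cotuple_obj (p : coproduct) : H := F (projT1 p) (projT2 p).

Definition cotuple_hom (p q : coproduct) :
  hom p q -> hom (cotuple_obj p) (cotuple_obj q).
Proof.
case: p q => [i x] [j y] [/= e f].
by case: j / e y f => y f; exact: (fhom (F i) f).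
Defined.

Lemma cotuple_hom1 p : cotuple_hom (gid p) = gid (cotuple_obj p).
Proof. by case: p => i x; exact: fhom1. Qed.

Lemma cotuple_homM p q r (g : @hom coproduct q r) (f : @hom coproduct p q) :
  cotuple_hom (gcomp g f) = gcomp (cotuple_hom g) (cotuple_hom f).
Proof.
case: p q r g f => [i x] [j y] [k z] [/= ejk g] [/= eij f].
case: k / ejk z g => z g; case: j / eij y z f g => y z f g; exact: fhomM.
Qed.

(** The functor out of the coproduct that restricts to [F j] on [G j]. *)
Definition cotuple : functor coproduct H := Functor cotuple_hom1 cotuple_homM.

End coproduct.

Section fundamental_groupoid.
Variable R : realType.

HB.instance Definition _ (X : closureSpace) (x y : X) :=
  gen_eqMixin (cpath R x y).
HB.instance Definition _ (X : closureSpace) (x y : X) :=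
  gen_choiceMixin (cpath R x y).

Section def.
Variable X : closureSpace.

Section homs.
Variables x y : X.

Definition homotopicb (v w : cpath R x y) : bool := `[< homotopic v w >].

Lemma homotopicb_refl : reflexive homotopicb.
Proof. by move=> v; apply/asboolP; exact: homotopic_refl. Qed.

Lemma homotopicb_sym : symmetric homotopicb.
Proof.
by move=> v w; apply/asboolP/asboolP => /homotopic_sym.
Qed.

Lemma homotopicb_trans : transitive homotopicb.
Proof.
move=> w v u /asboolP vw /asboolP wu; apply/asboolP.
exact: homotopic_trans vw wu.
Qed.

Canonical homotopic_equiv :=
  EquivRel homotopicb homotopicb_refl homotopicb_sym homotopicb_trans.

Definition path_class := {eq_quot homotopic_equiv}.

Definition cls (v : cpath R x y) : path_class := \pi v.

Lemma clsP (v w : cpath R x y) : cls v = cls w <-> homotopic v w.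
Proof. by split=> [/eqquotP/asboolP|vw]//; apply/eqquotP/asboolP. Qed.

Lemma cls_repr (f : path_class) : cls (repr f) = f.
Proof. exact: reprK. Qed.

Lemma repr_cls (v : cpath R x y) : homotopic (repr (cls v)) v.
Proof. by apply/clsP; rewrite cls_repr. Qed.

End homs.

(** [g] after [f]: the class of the concatenation "first [f], then [g]" *)
Definition class_comp (x y z : X) (g : path_class y z) (f : path_class x y) :
  path_class x z := cls (cat_cpath (repr f) (repr g)).

Definition class_id (x : X) : path_class x x := cls (cst_cpath R x).

Definition class_inv (x y : X) (f : path_class x y) : path_class y x :=
  cls (rev_cpath (repr f)).

Lemma class_compE (x y z : X) (v : cpath R x y) (w : cpath R y z) :
  class_comp (cls w) (cls v) = cls (cat_cpath v w).
Proof. by apply/clsP/homotopic_cat; exact: repr_cls. Qed.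

Lemma class_invE (x y : X) (v : cpath R x y) :
  class_inv (cls v) = cls (rev_cpath v).
Proof. by apply/clsP/homotopic_rev; exact: repr_cls. Qed.

Lemma class_compA x y z t (h : path_class z t) (g : path_class y z)
    (f : path_class x y) :
  class_comp h (class_comp g f) = class_comp (class_comp h g) f.
Proof.
rewrite -(cls_repr h) -(cls_repr g) -(cls_repr f) !class_compE.
by apply/clsP/homotopic_sym; exact: homotopic_catA.
Qed.

Lemma class_comp1f x y (f : path_class x y) : class_comp (class_id y) f = f.
Proof.
by rewrite -(cls_repr f) class_compE; apply/clsP; exact: homotopic_cat1.
Qed.

Lemma class_compf1 x y (f : path_class x y) : class_comp f (class_id x) = f.
Proof.
by rewrite -(cls_repr f) class_compE; apply/clsP; exact: homotopic_1cat.
Qed.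

Lemma class_compVf x y (f : path_class x y) :
  class_comp (class_inv f) f = class_id x.
Proof.
rewrite -(cls_repr f) class_invE class_compE.
by apply/clsP; exact: homotopic_catV.
Qed.

Lemma class_compfV x y (f : path_class x y) :
  class_comp f (class_inv f) = class_id y.
Proof.
rewrite -(cls_repr f) class_invE class_compE.
by apply/clsP; exact: homotopic_Vcat.
Qed.

Definition Pi : groupoid :=
  Groupoid class_compA class_comp1f class_compf1 class_compVf class_compfV.

(** [PiA A] is Pi(X, A). *)
Definition PiA (A : set X) : groupoid := @full_subgroupoid Pi A.

Definition path_component (x : X) : set X :=
  [set y | exists v : cpath R x y, True].

Definition meets_path_components (A : set X) : Prop :=
  forall x : X, path_component x `&` A !=set0.

End def.

Section induced.
Variables (X Y : closureSpace) (f : cs_map X Y).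

Definition class_map (x y : X) (g : path_class x y) : path_class (f x) (f y) :=
  cls (map_cpath f (repr g)).

Lemma class_mapE (x y : X) (v : cpath R x y) :
  class_map (cls v) = cls (map_cpath f v).
Proof. by apply/clsP/homotopic_map; exact: repr_cls. Qed.

Lemma class_map1 (x : X) : class_map (class_id x) = class_id (f x).
Proof. by rewrite class_mapE; apply/clsP; exact: map_cst_cpath. Qed.

Lemma class_mapM x y z (h : path_class y z) (g : path_class x y) :
  class_map (class_comp h g) = class_comp (class_map h) (class_map g).
Proof.
rewrite -(cls_repr h) -(cls_repr g) class_compE !class_mapE class_compE.
by apply/clsP; exact: map_cat_cpath.
Qed.

Definition Pi_map : functor (Pi X) (Pi Y) :=
  @Functor (Pi X) (Pi Y) f class_map class_map1 class_mapM.

Definition PiA_map (A : set X) (B : set Y) (AB : forall x, A x -> B (f x)) :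
  functor (PiA A) (PiA B) := @full_functor (Pi X) (Pi Y) Pi_map A B AB.

End induced.

End fundamental_groupoid.

Section inclusions.
Variable X : closureSpace.

Lemma incl_continuous (S : set X) : @cs_continuous (sub_cs S) X set_val.
Proof. by move=> B _ [x cx <-]. Qed.

Definition incl (S : set X) : cs_map (sub_cs S) X := CsMap (@incl_continuous S).

Variables (S T : set X) (ST : S `<=` T).

Definition incl_sub_fun (x : S) : T := SigSub (mem_set (ST (set_valP x))).

Lemma incl_sub_continuous :
  @cs_continuous (sub_cs S) (sub_cs T) incl_sub_fun.
Proof.
move=> B _ [x cx <-].
have : @cl X (set_val @` B) (set_val x) by exact: cx.
apply: clS => _ [y By <-].
by exists (incl_sub_fun y) => //; exists y.
Qed.

Definition incl_sub : cs_map (sub_cs S) (sub_cs T) := CsMap incl_sub_continuous.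

End inclusions.

Section diagram.
Variables (R : realType) (X : closureSpace) (A : Type) (U : A -> set X).
Variable X0 : set X.

(** [PiU S] is Pi(S, X0 `&` S), for [S] with the subspace closure. *)
Definition PiU (S : set X) : groupoid :=
  @PiA R (sub_cs S) (set_val @^-1` X0).

(** [U^nu] for [nu] in [A^n], written as a map ['I_n -> A] *)
Definition multi_cap (n : nat) (nu : 'I_n -> A) : set X :=
  \bigcap_(i in [set: 'I_n]) U (nu i).

Lemma multi_cap_sub n (nu : 'I_n -> A) i : multi_cap nu `<=` U (nu i).
Proof. exact: bigcap_inf. Qed.

Definition single_cover : groupoid := coproduct (fun al : A => PiU (U al)).

Definition double_cover : groupoid :=
  coproduct (fun nu : 'I_2 -> A => PiU (multi_cap nu)).

(** Induced by the inclusions of [U^nu] in [U (nu i)]; the functor [a] of the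
   diagram is the case [i = ord0], and [b] the case [i = ord_max]. *)
Definition double_to_single (i : 'I_2) : functor double_cover single_cover :=
  cotuple (fun nu : 'I_2 -> A =>
    fcomp (coproj (fun al : A => PiU (U al)) (nu i))
      (@PiA_map R _ _ (incl_sub (@multi_cap_sub 2 nu i))
         (set_val @^-1` X0) (set_val @^-1` X0) (fun x X0x => X0x))).

Definition single_to_space : functor single_cover (@PiA R X X0) :=
  cotuple (fun al : A =>
    @PiA_map R _ _ (incl (U al)) (set_val @^-1` X0) X0 (fun x X0x => X0x)).

End diagram.

(* Main.v *)
From mathcomp Require Import all_boot all_order all_algebra.
From mathcomp Require Import ring lra.
From mathcomp Require Import boolp classical_sets functions reals topology.
From mathcomp Require Import normedtype.
Require Import Defs.

(** Call a path small if it lies in a single member of the cover. A functor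
   [F] out of the disjoint union of the Pi(U^al, U^al_0) that coequalizes the
   two functors of the diagram is the same thing as a rule assigning a
   morphism of [L] to every small path with end points in [X0],
   multiplicatively, and invariantly under homotopies that stay in one member
   of the cover: the coequalizing condition says exactly that the member
   chosen to contain a small path is irrelevant. Such a rule is a
   [small_functor] on [X0], and the theorem says that it extends uniquely to
   all paths.

   The extension has two steps. The points connected to [X0] by a small path
   form a set [reach]. The hypothesis on intersections of distinct members
   gives [cover_reach_triples]: a point of [reach] lying in three members of
   the cover, equal or not, is joined to [X0] inside their intersection. A
   component of a single [U^al] that misses [X0] is therefore never met when
   starting from [X0]. Two-fold intersections suffice to define a value of
   [F] on paths from [x] to [X0], relative to a chosen object over [x] (a
   [frame]); the three-fold ones make these values independent of the member
   of the cover in which they are computed. Comparing frames at the two ends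
   of a small path turns the small functor on [X0] into one on [reach]
   ([reach_functor]).

   On [reach] no auxiliary connecting paths are needed any more, because a
   small path starting in [reach] stays there. Transport along a path is then
   the composite of the values of the pieces of a subdivision, and it is well
   defined ([transport_unique_ex]) and homotopy invariant ([rectangle01]).
   Both facts have the form: a property of intervals that is additive and
   holds for all short intervals holds for the unit interval
   ([interval_additive]); this plays the role of the Lebesgue number.
   Homotopy invariance applies it once in each direction to the property that
   transport commutes around a rectangle.

   Uniqueness ([functors_eq]) is the same additivity argument for the
   property that two functors agree on a piece of a path, closed up at both
   ends by arbitrary small paths to [X0]. *)

Set Implicit Arguments.
Unset Strict Implicit.
Unset Printing Implicit Defensive.

Import Order.TTheory GRing.Theory Num.Theory.
Import numFieldNormedType.Exports.

Local Open Scope classical_set_scope.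
Local Open Scope ring_scope.

(** * Groupoids and functors *)

Section groupoid_algebra.
Variable L : groupoid.

Lemma gcomp_injl (x y z : L) (h : hom y z) (f g : hom x y) :
  gcomp h f = gcomp h g -> f = g.
Proof.
by move=> e; rewrite -[f]gcomp1f -[g]gcomp1f -(gcompVf h) -!gcompA e.
Qed.

Lemma gcomp_injr (x y z : L) (h : hom x y) (f g : hom y z) :
  gcomp f h = gcomp g h -> f = g.
Proof.
by move=> e; rewrite -[f]gcompf1 -[g]gcompf1 -(gcompfV h) !gcompA e.
Qed.

Lemma gcompKV (x y z : L) (h : hom x y) (f : hom z y) :
  gcomp h (gcomp (ginv h) f) = f.
Proof. by rewrite gcompA gcompfV gcomp1f. Qed.

Lemma gcompVK (x y z : L) (h : hom y x) (f : hom z y) :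
  gcomp (ginv h) (gcomp h f) = f.
Proof. by rewrite gcompA gcompVf gcomp1f. Qed.

Lemma gcomp_idem (x : L) (f : hom x x) : gcomp f f = f -> f = gid x.
Proof. by move=> ff; apply: (@gcomp_injl _ _ _ f); rewrite ff gcompf1. Qed.

(** An equality of objects as a morphism. Equalities between values of
   functors are only provable, so every comparison of morphisms across them
   goes through these. *)
Definition idto (x y : L) (e : x = y) : hom x y :=
  eq_rect x (hom x) (gid x) y e.

Lemma idto_id (x : L) (e : x = x) : idto e = gid x.
Proof. by rewrite (Prop_irrelevance e erefl). Qed.

Lemma idto_trans (x y z : L) (e : x = y) (e' : y = z) (e'' : x = z) :
  gcomp (idto e') (idto e) = idto e''.
Proof. by subst y z; rewrite !idto_id gcomp1f. Qed.

End groupoid_algebra.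

(** Equality of functors in the form of a natural transformation whose
   components are the identities [idto]: no cast appears in the hypothesis. *)
Lemma functor_ext (G H : groupoid) (F F' : functor G H)
    (e : forall x, F x = F' x) :
  (forall x y (f : hom x y),
    gcomp (idto (e y)) (fhom F f) = gcomp (fhom F' f) (idto (e x))) ->
  F = F'.
Proof.
case: F F' e => [o h h1 hM] [o' h' h1' hM'] /= e.
have eo : o = o' by apply: funext.
subst o' => nat.
have eh : h = h'.
  apply: functional_extensionality_dep => x.
  apply: functional_extensionality_dep => y.
  apply: functional_extensionality_dep => f.
  by have := nat _ _ f; rewrite !idto_id gcomp1f gcompf1.
by subst h'; congr Functor; exact: Prop_irrelevance.
Qed.

Lemma functor_eq_obj (G H : groupoid) (F F' : functor G H) (x : G) :
  F = F' -> F x = F' x.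
Proof. by move=> ->. Qed.

Lemma functor_eq_hom (G H : groupoid) (F F' : functor G H) (x y : G)
    (f : hom x y) (ex : F x = F' x) (ey : F y = F' y) :
  F = F' -> gcomp (idto ey) (fhom F f) = gcomp (fhom F' f) (idto ex).
Proof. by move=> e; subst F'; rewrite !idto_id gcomp1f gcompf1. Qed.

(** * Paths and homotopies inside a subset *)

Section homotopy_within.
Variables (R : realType) (X : closureSpace).
Local Notation I := (II R).

Definition within (S : set X) (x y : X) (v : cpath R x y) := forall s, S (v s).

(** Homotopy of paths of [X] through [S]. It amounts to homotopy in the
   subspace [S] ([homotopic_withinP]), but has end points of type [X], so that
   the same path can be considered in several members of a cover without
   casts. *)
Definition homotopic_within (S : set X) (x y : X) (v w : cpath R x y) : Prop :=
  exists H : prod_cs I I -> X,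
    [/\ cs_continuous H,
        forall s, H (s, I0 R) = v s, forall s, H (s, I1 R) = w s,
        forall t, H (I0 R, t) = x & forall t, H (I1 R, t) = y] /\
    forall p, S (H p).

Section basics.
Variable S : set X.

Lemma within_src x y (v : cpath R x y) : within S v -> S x.
Proof. by move=> /(_ (I0 R)); rewrite cpath0. Qed.

Lemma within_tgt x y (v : cpath R x y) : within S v -> S y.
Proof. by move=> /(_ (I1 R)); rewrite cpath1. Qed.

Lemma within_cst x : S x -> within S (cst_cpath R x).
Proof. by move=> Sx s. Qed.

Lemma within_rev x y (v : cpath R x y) : within S v -> within S (rev_cpath v).
Proof. by move=> Sv s; exact: Sv. Qed.

Lemma within_cat x y z (v : cpath R x y) (w : cpath R y z) :
  within S v -> within S w -> within S (cat_cpath v w).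
Proof. by move=> Sv Sw s; rewrite /= /cat_fun; case: ifP. Qed.

Lemma within_catl x y z (v : cpath R x y) (w : cpath R y z) :
  within S (cat_cpath v w) -> within S v.
Proof.
move=> Sc s; have /andP[s0 s1] := unitI_itv s.
(* the time at which the concatenation passes through [v s] *)
have := Sc (affI 2^-1 0 s); rewrite /= /cat_fun affI_val ?ifT; try lra.
by rewrite (@affIE _ _ _ _ (set_val s)) ?valIK// affI_val; lra.
Qed.

Lemma within_catr x y z (v : cpath R x y) (w : cpath R y z) :
  within S (cat_cpath v w) -> within S w.
Proof.
move=> Sc s; have /andP[s0 s1] := unitI_itv s.
have := Sc (affI 2^-1 2^-1 s); rewrite /= /cat_fun affI_val; last by lra.
case: ifPn => [s2|_].
  (* at the breakpoint the concatenation is given by the end of [v] *)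
  have -> : s = I0 R by rewrite -(valIK s) /I0; congr toI; lra.
  rewrite (@affIE _ _ _ _ 1) -/(I1 R) ?cpath1 ?cpath0//.
  by rewrite affI_val valI0; lra.
by rewrite (@affIE _ _ _ _ (set_val s)) ?valIK// affI_val; lra.
Qed.

Lemma lift_continuous (P : closureSpace) (f : P -> X) (Sf : forall p, S (f p)) :
  cs_continuous f ->
  @cs_continuous P (sub_cs S) (fun p => SigSub (mem_set (Sf p))).
Proof.
move=> cf B _ [p cp <-].
have : cl (f @` B) (f p) by apply: cf; exists p.
by apply: clS => _ [q Bq <-]; eexists; [exists q; first exact: Bq|].
Qed.

Lemma sub_inj (p q : S) : set_val p = set_val q -> p = q.
Proof. by move=> pq; apply: val_inj. Qed.

Variables (x y : sub_cs S).

Definition lift_fun (v : cpath R (set_val x) (set_val y)) (Sv : within S v)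
    (s : I) : sub_cs S := SigSub (mem_set (Sv s)).

Lemma lift_fun0 v (Sv : within S v) : lift_fun Sv (I0 R) = x.
Proof. by apply: sub_inj; exact: (cpath0 v). Qed.

Lemma lift_fun1 v (Sv : within S v) : lift_fun Sv (I1 R) = y.
Proof. by apply: sub_inj; exact: (cpath1 v). Qed.

Definition lift_cpath (v : cpath R (set_val x) (set_val y)) (Sv : within S v) :
  cpath R x y :=
  CPath (@lift_continuous _ _ Sv (@cpath_continuous _ _ _ _ v))
    (lift_fun0 Sv) (lift_fun1 Sv).

Lemma homotopic_withinP (v w : cpath R (set_val x) (set_val y))
    (Sv : within S v) (Sw : within S w) :
  homotopic (lift_cpath Sv) (lift_cpath Sw) <-> homotopic_within S v w.
Proof.
split=> [[H [cH H0 H1 Hx Hy]]|[H [[cH H0 H1 Hx Hy] SH]]].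
  exists (set_val \o H); split; [split|] => /=.
  - exact: (cs_continuous_comp (@incl_continuous X S) cH).
  - by move=> s; rewrite H0.
  - by move=> s; rewrite H1.
  - by move=> t; rewrite Hx.
  - by move=> t; rewrite Hy.
  - by move=> p; exact: set_valP.
exists (fun p => SigSub (mem_set (SH p))); split=> [|s|s|t|t].
- exact: lift_continuous.
- by apply: val_inj; exact: H0.
- by apply: val_inj; exact: H1.
- by apply: val_inj; exact: Hx.
- by apply: val_inj; exact: Hy.
Qed.

End basics.

Section calculus.
Variable S : set X.

Definition sub_point (x : X) (Sx : S x) : sub_cs S := SigSub (mem_set Sx).

(** The class of [v] in the fundamental groupoid of [S]. The laws of
   [homotopic_within] below are groupoid identities between such classes. *)
Definition class_within (x y : X) (Sx : S x) (Sy : S y) (v : cpath R x y)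
    (Sv : within S v) : @hom (Pi R (sub_cs S)) (sub_point Sx) (sub_point Sy) :=
  cls (@lift_cpath S (sub_point Sx) (sub_point Sy) v Sv).

Lemma class_within_eq (x y : X) (Sx : S x) (Sy : S y) (v w : cpath R x y)
    (Sv : within S v) (Sw : within S w) :
  class_within Sx Sy Sv = class_within Sx Sy Sw <-> homotopic_within S v w.
Proof.
rewrite -(@homotopic_withinP S (sub_point Sx) (sub_point Sy) v w Sv Sw).
exact: clsP.
Qed.

Lemma class_within_cat (x y z : X) (Sx : S x) (Sy : S y) (Sz : S z)
    (v : cpath R x y) (w : cpath R y z) (Sv : within S v) (Sw : within S w)
    (Svw : within S (cat_cpath v w)) :
  class_within Sx Sz Svw = gcomp (class_within Sy Sz Sw) (class_within Sx Sy Sv).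
Proof.
rewrite /= class_compE; apply/clsP/eq_homotopic => s.
by apply: val_inj; rewrite /= /cat_fun; case: ifP.
Qed.

Lemma class_within_rev (x y : X) (Sx : S x) (Sy : S y) (v : cpath R x y)
    (Sv : within S v) (Svr : within S (rev_cpath v)) :
  class_within Sy Sx Svr = ginv (class_within Sx Sy Sv).
Proof.
by rewrite /= class_invE; apply/clsP/eq_homotopic => s; apply: val_inj.
Qed.

Lemma homotopic_within_refl x y (v : cpath R x y) :
  within S v -> homotopic_within S v v.
Proof.
by move=> Sv; apply/(class_within_eq (within_src Sv) (within_tgt Sv) Sv Sv).
Qed.

Lemma homotopic_within_eq x y (v w : cpath R x y) :
  within S v -> (forall s, v s = w s) -> homotopic_within S v w.
Proof.
move=> Sv vw; have Sw : within S w by move=> s; rewrite -vw.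
apply/(class_within_eq (within_src Sv) (within_tgt Sv) Sv Sw)/clsP.
by apply: eq_homotopic => s; apply: val_inj; exact: vw.
Qed.

Lemma homotopic_within_cat x y z (v v' : cpath R x y) (w w' : cpath R y z) :
  homotopic_within S v v' -> homotopic_within S w w' ->
  homotopic_within S (cat_cpath v w) (cat_cpath v' w').
Proof.
move=> hv hw.
have [Sv Sv'] : within S v /\ within S v'.
  by case: hv => H [[_ H0 H1 _ _] SH]; split=> s; [rewrite -H0|rewrite -H1].
have [Sw Sw'] : within S w /\ within S w'.
  by case: hw => H [[_ H0 H1 _ _] SH]; split=> s; [rewrite -H0|rewrite -H1].
have Sx := within_src Sv; have Sy := within_tgt Sv; have Sz := within_tgt Sw.
apply/(class_within_eq Sx Sz (within_cat Sv Sw) (within_cat Sv' Sw')).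
rewrite (class_within_cat Sx Sy Sz Sv Sw) (class_within_cat Sx Sy Sz Sv' Sw').
by congr gcomp; apply/class_within_eq.
Qed.

Lemma homotopic_within_catA x y z t (u : cpath R x y) (v : cpath R y z)
    (w : cpath R z t) : within S u -> within S v -> within S w ->
  homotopic_within S (cat_cpath u (cat_cpath v w)) (cat_cpath (cat_cpath u v) w).
Proof.
move=> Su Sv Sw; have Svw := within_cat Sv Sw; have Suv := within_cat Su Sv.
have Sx := within_src Su; have Sy := within_src Sv.
have Sz := within_src Sw; have St := within_tgt Sw.
apply/(class_within_eq Sx St (within_cat Su Svw) (within_cat Suv Sw)).
rewrite (class_within_cat Sx Sy St Su Svw) (class_within_cat Sy Sz St Sv Sw).
by rewrite (class_within_cat Sx Sz St Suv Sw) (class_within_cat Sx Sy Sz Su Sv)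
  gcompA.
Qed.

Lemma homotopic_within_cancel x y z t (u : cpath R x y) (v : cpath R y z)
    (w : cpath R y t) : within S u -> within S v -> within S w ->
  homotopic_within S (cat_cpath (cat_cpath u v) (cat_cpath (rev_cpath v) w))
    (cat_cpath u w).
Proof.
move=> Su Sv Sw; have Suv := within_cat Su Sv; have Sr := within_rev Sv.
have Srw := within_cat Sr Sw; have Suw := within_cat Su Sw.
have Sx := within_src Su; have Sy := within_src Sv.
have Sz := within_tgt Sv; have St := within_tgt Sw.
apply/(class_within_eq Sx St (within_cat Suv Srw) Suw).
rewrite (class_within_cat Sx Sz St Suv Srw) (class_within_cat Sx Sy Sz Su Sv).
rewrite (class_within_cat Sz Sy St Sr Sw) (class_within_rev Sy Sz Sv).
by rewrite (class_within_cat Sx Sy St Su Sw) -gcompA gcompVK.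
Qed.

Lemma homotopic_within_catVK x y z (v : cpath R x y) (w : cpath R x z) :
  within S v -> within S w ->
  homotopic_within S (cat_cpath v (cat_cpath (rev_cpath v) w)) w.
Proof.
move=> Sv Sw; have Sr := within_rev Sv; have Srw := within_cat Sr Sw.
have Sx := within_src Sv; have Sy := within_tgt Sv; have Sz := within_tgt Sw.
apply/(class_within_eq Sx Sz (within_cat Sv Srw) Sw).
rewrite (class_within_cat Sx Sy Sz Sv Srw) (class_within_cat Sy Sx Sz Sr Sw).
by rewrite (class_within_rev Sx Sy Sv) -gcompA gcompVf gcompf1.
Qed.

Lemma homotopic_within_cat1 x y (v : cpath R x y) : within S v ->
  homotopic_within S (cat_cpath v (cst_cpath R y)) v.
Proof.
move=> Sv; have Sx := within_src Sv; have Sy := within_tgt Sv.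
have Sc := @within_cst S y Sy.
apply/(class_within_eq Sx Sy (within_cat Sv Sc) Sv).
rewrite (class_within_cat Sx Sy Sy Sv Sc).
have -> : class_within Sy Sy Sc = @gid (Pi R (sub_cs S)) (sub_point Sy);
  last by rewrite gcomp1f.
by apply/clsP/eq_homotopic => s; apply: val_inj.
Qed.

Lemma homotopic_within_1cat x y (v : cpath R x y) : within S v ->
  homotopic_within S (cat_cpath (cst_cpath R x) v) v.
Proof.
move=> Sv; have Sx := within_src Sv; have Sy := within_tgt Sv.
have Sc := @within_cst S x Sx.
apply/(class_within_eq Sx Sy (within_cat Sc Sv) Sv).
rewrite (class_within_cat Sx Sx Sy Sc Sv).
have -> : class_within Sx Sx Sc = @gid (Pi R (sub_cs S)) (sub_point Sx);
  last by rewrite gcompf1.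
by apply/clsP/eq_homotopic => s; apply: val_inj.
Qed.

End calculus.
End homotopy_within.

(** * Additive properties of intervals and convex homotopies *)

(** The supremum of the [t] with [Q 0 t] is attained, and cannot be less than
   1, because [Q] holds on short intervals around it. *)
Lemma interval_additive (R : realType) (Q : R -> R -> Prop) :
  (forall a b c, 0 <= a -> a <= b -> b <= c -> c <= 1 ->
    Q a b -> Q b c -> Q a c) ->
  (forall s, 0 <= s <= 1 -> exists2 e, 0 < e & forall a b,
    0 <= a -> a <= b -> b <= 1 -> s - e < a -> b < s + e -> Q a b) ->
  Q 0 1.
Proof.
move=> Qadd Qloc.
pose S := [set t : R | 0 <= t <= 1 /\ Q 0 t].
have S0 : S 0.
  have [|e e0 He] := Qloc 0; first by lra.
  by split; [lra|apply: He; lra].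
have Sub : ubound S 1 by move=> t [] /andP[].
have supS : has_sup S by split; [exists 0|exists 1].
have T0 : 0 <= sup S by apply: ub_le_sup S0; exists 1.
have T1 : sup S <= 1 by apply: ge_sup => //; exists 0.
have [|e e0 He] := Qloc (sup S); first by lra.
have [t [/andP[t0 t1] Qt] tS] := sup_adherent e0 supS.
have tT : t <= sup S by apply: ub_le_sup; [exists 1|split=> //; lra].
pose b := Num.min (sup S + e / 2) 1.
have tb : t <= b by rewrite le_min t1 andbT; lra.
have b1 : b <= 1 by rewrite ge_min lexx orbT.
have bT : b <= sup S + e / 2 by rewrite ge_min lexx.
have Qb : Q 0 b by apply: (Qadd 0 t b) => //; apply: He => //; lra.
suff <- : b = 1 by [].
have bS : b <= sup S by apply: ub_le_sup; [exists 1|split=> //; lra].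
by move: bS; rewrite /b; case: (leP (sup S + e / 2) 1) => //; lra.
Qed.

Section convex_homotopies.
Variables (R : realType) (W : normedModType R).
Local Notation I := (II R).

Definition convex_set_in (C : set W) : Prop :=
  forall p q (t : R), 0 <= t <= 1 -> C p -> C q -> C ((1 - t) *: p + t *: q).

Lemma cs_continuous_top (T S : topologicalType) (f : T -> S) :
  @cs_continuous (top_cs T) (top_cs S) f -> continuous f.
Proof.
move=> cf x B fB.
have /(cs_continuous_nbhs cf) : @cs_nbhs (top_cs S) (f x) B by apply/top_cs_nbhs.
by move/top_cs_nbhs.
Qed.

Definition line_fun (p q : W) (s : I) : top_cs W :=
  (1 - set_val s) *: p + set_val s *: q.

Lemma line_continuous p q : @cs_continuous I (top_cs W) (line_fun p q).
Proof.
apply: (@top_cs_continuous (unitI R) W (line_fun p q)).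
have c : continuous (set_val : unitI R -> R^o) by exact: valI_continuous.
have c' : continuous (fun s : unitI R => 1 - set_val s : R^o).
  by move=> s; exact: (cvgB (cvg_cst (1 : R^o)) (c s)).
have cZ (u : unitI R -> R^o) (a : W) :
    continuous u -> continuous (fun s => u s *: a : W).
  by move=> cu s; exact: (@cvgZr_tmp _ _ _ _ _ _ _ a (cu s)).
move=> s; exact: (cvgD (cZ _ p c' s) (cZ _ q c s)).
Qed.

Lemma line0 p q : line_fun p q (I0 R) = p.
Proof. by rewrite /line_fun valI0 subr0 scale1r scale0r addr0. Qed.

Lemma line1 p q : line_fun p q (I1 R) = q.
Proof. by rewrite /line_fun valI1 subrr scale1r scale0r add0r. Qed.

Definition line (p q : W) : @cpath R (top_cs W) p q :=
  CPath (@line_continuous p q) (line0 p q) (line1 p q).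

Lemma within_line C p q : convex_set_in C -> C p -> C q ->
  @within R (top_cs W) C p q (line p q).
Proof. by move=> cC Cp Cq s; apply: cC => //; exact: unitI_itv. Qed.

(** The straight-line homotopy in [W], carried to [X] by [h]. *)
Lemma convex_homotopic (X : closureSpace) (h : W -> X) (C : set W) (S : set X)
    (p q : W) (f g : @cpath R (top_cs W) p q) (x y : X) (v w : cpath R x y) :
  @cs_continuous (top_cs W) X h -> convex_set_in C -> C `<=` h @^-1` S ->
  @within R (top_cs W) C p q f -> @within R (top_cs W) C p q g ->
  (forall s, v s = h (f s)) -> (forall s, w s = h (g s)) ->
  homotopic_within S v w.
Proof.
move=> ch cC CS Cf Cg vf wg.
pose K (r : unitI R * unitI R) : W :=
  (1 - set_val r.2) *: (f r.1 : W) + set_val r.2 *: (g r.1 : W).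
have c1 (k : @cpath R (top_cs W) p q) :
    continuous (fun r : unitI R * unitI R => k r.1 : W).
  move=> r; apply: (@continuous_comp _ _ _ fst (k : unitI R -> W)).
    exact: cvg_fst.
  apply: cs_continuous_top; exact: (@cpath_continuous _ _ _ _ k).
have c2 : continuous (fun r : unitI R * unitI R => set_val r.2 : R).
  by move=> r; apply: continuous_comp; [exact: cvg_snd|exact: valI_continuous].
have cK : continuous K.
  move=> r; apply: cvgD; apply: cvgZ; [|exact: c1|exact: c2|exact: c1].
  by apply: (@cvgB _ R^o); [exact: cvg_cst|exact: c2].
exists (h \o K); split; first split=> /= [|s|s|t|t].
- exact: (@cs_continuous_comp (prod_cs I I) (top_cs W) X h K ch
    (prod_top_cs_continuous cK)).
- by rewrite vf /K /= valI0 subr0 scale1r scale0r addr0.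
- by rewrite wg /K /= valI1 subrr scale1r scale0r add0r.
- by rewrite -(cpath0 v) vf /K /= !cpath0 -scalerDl subrK scale1r.
- by rewrite -(cpath1 v) vf /K /= !cpath1 -scalerDl subrK scale1r.
- move=> r; apply: CS; apply: cC; [exact: unitI_itv|exact: Cf|exact: Cg].
Qed.

Lemma locally_in_cover (X : closureSpace) (A : Type) (U : A -> set X)
    (h : W -> X) : interior_cover U -> @cs_continuous (top_cs W) X h ->
  forall p, exists2 e : R, 0 < e & exists al, forall q, ball p e q -> U al (h q).
Proof.
move=> Uc ch p; have [al /(cs_continuous_nbhs ch)/top_cs_nbhs] := Uc (h p).
by move=> /nbhs_ballP[e /= e0 He]; exists e => //; exists al.
Qed.

End convex_homotopies.

(** * Small functors and transport along paths *)

Section small_functors.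
Variables (R : realType) (X : closureSpace) (A : Type) (U : A -> set X).
Variable L : groupoid.

Definition small (x y : X) (v : cpath R x y) : Prop :=
  exists al, within (U al) v.

(** The member of the cover that contains a small path is existentially
   quantified in [small], so the value [sf_hom] cannot depend on it. *)
Record small_functor (B : set X) := SmallFunctor {
  sf_obj :> B -> L;
  sf_hom : forall (x y : B) (v : cpath R (set_val x) (set_val y)),
    small v -> hom (sf_obj x) (sf_obj y);
  sf_htp : forall al (x y : B) (v w : cpath R (set_val x) (set_val y))
    (sv : small v) (sw : small w),
    homotopic_within (U al) v w -> sf_hom sv = sf_hom sw;
  sf_cat : forall (x y z : B) (v : cpath R (set_val x) (set_val y))
    (w : cpath R (set_val y) (set_val z)) (sv : small v) (sw : small w)
    (svw : small (cat_cpath v w)),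
    sf_hom svw = gcomp (sf_hom sw) (sf_hom sv)
}.

Definition small_stable (B : set X) : Prop :=
  forall x y (v : cpath R x y), small v -> B x -> B y.

Lemma sf_irr B (F : small_functor B) (x y : B)
    (v : cpath R (set_val x) (set_val y)) (sv sv' : small v) :
  sf_hom F sv = sf_hom F sv'.
Proof. by congr sf_hom; exact: Prop_irrelevance. Qed.

Lemma sf_cst B (F : small_functor B) (x : B)
    (s : small (cst_cpath R (set_val x))) : sf_hom F s = gid (F x).
Proof.
apply: gcomp_idem; have [al Us] := s.
have s2 : small (cat_cpath (cst_cpath R (set_val x)) (cst_cpath R (set_val x))).
  by exists al; exact: within_cat.
rewrite -(sf_cat F s s s2).
by apply: (sf_htp F (al := al)); exact: homotopic_within_cat1.
Qed.

Section transport.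
Variables (B : set X) (F : small_functor B).
Hypothesis Bst : small_stable B.
Hypothesis Ucov : interior_cover U.

Definition runs (V : R -> X) (a b : R) (x y : X) (v : cpath R x y) : Prop :=
  forall s, v s = V ((1 - set_val s) * a + set_val s * b).

(** A relation rather than a function: the pieces of a subdivision are not
   canonical. The end points are carried along as elements [x] and [y] of [B],
   equal to [V a] and [V b] only provably, which avoids casts between objects
   of [L]. *)
Inductive transport (V : R -> X) :
    R -> R -> forall x y : B, hom (F x) (F y) -> Prop :=
| transport_small a b (x y : B) (v : cpath R (set_val x) (set_val y))
    (sv : small v) : a <= b -> runs V a b v -> transport V a b (sf_hom F sv)
| transport_cat a b c (x y z : B) (m : hom (F x) (F y)) (n : hom (F y) (F z)) :
    transport V a b m -> transport V b c n -> transport V a c (gcomp n m).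

Section along.
Variable V : R -> X.

Lemma runs_src a b x y (v : cpath R x y) : runs V a b v -> x = V a.
Proof.
by move=> vV; rewrite -(cpath0 v) vV valI0 subr0 mul1r mul0r addr0.
Qed.

Lemma runs_tgt a b x y (v : cpath R x y) : runs V a b v -> y = V b.
Proof.
by move=> vV; rewrite -(cpath1 v) vV valI1 subrr mul1r mul0r add0r.
Qed.

Lemma transport_le a b x y (m : hom (F x) (F y)) : transport V a b m -> a <= b.
Proof. by elim=> // ? ? ? ? ? ? ? ? _ ab _ /(le_trans ab). Qed.

Lemma transport_src a b x y (m : hom (F x) (F y)) :
  transport V a b m -> set_val x = V a.
Proof. by elim=> // ? ? ? ? ? _ _; exact: runs_src. Qed.

Lemma transport_tgt a b x y (m : hom (F x) (F y)) :
  transport V a b m -> set_val y = V b.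
Proof. by elim=> // ? ? ? ? ? _ _; exact: runs_tgt. Qed.

Lemma runs_within S a b x y (v : cpath R x y) : a <= b -> runs V a b v ->
  (forall r, a <= r <= b -> S (V r)) -> within S v.
Proof.
move=> ab vV SV s; rewrite vV; apply: SV.
by have /andP[s0 s1] := unitI_itv s; nra.
Qed.

Lemma within_runs S a b x y (v : cpath R x y) : runs V a b v -> within S v ->
  forall r, a <= r <= b -> S (V r).
Proof.
move=> vV Sv r /andP[ar rb].
have [ab|ab] := ltP a b; last first.
  have -> : r = a by lra.
  by rewrite -(runs_src vV); exact: within_src Sv.
have ba : 0 < b - a by lra.
have s01 : 0 <= (r - a) / (b - a) <= 1.
  by rewrite divr_ge0 ?ler_pdivrMr//; lra.
have rE : (1 - (r - a) / (b - a)) * a + (r - a) / (b - a) * b = r.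
  by field; lra.
by have := Sv (toI ((r - a) / (b - a))); rewrite vV toIK// rE.
Qed.

Hypothesis cV : @cs_continuous (top_cs R) X V.

Lemma runs_ex a b x y : x = V a -> y = V b -> exists v : cpath R x y, runs V a b v.
Proof.
move=> xa yb.
have cv := @cs_continuous_comp (II R) (top_cs R^o) X V _ cV
  (@line_continuous R R^o a b).
have v0 : (V \o line_fun (a : R^o) b) (I0 R) = x by rewrite /= line0.
have v1 : (V \o line_fun (a : R^o) b) (I1 R) = y by rewrite /= line1.
by exists (CPath cv v0 v1) => s.
Qed.

Lemma convex_itv (a b : R) : @convex_set_in R R^o [set r : R | a <= r <= b].
Proof.
move=> p q t /andP[t0 t1] /= /andP[ap pb] /andP[aq qb].
by rewrite /GRing.scale /=; nra.
Qed.

Lemma runs_cat S a b c x y z (u : cpath R x z) (v : cpath R x y)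
    (w : cpath R y z) : a <= b -> b <= c ->
  (forall r, a <= r <= c -> S (V r)) ->
  runs V a c u -> runs V a b v -> runs V b c w ->
  homotopic_within S (cat_cpath v w) u.
Proof.
move=> ab bc SV ru rv rw.
apply: (@convex_homotopic R R^o X V [set r : R | a <= r <= c] S a c
  (cat_cpath (@line R R^o a b) (@line R R^o b c)) (@line R R^o a c)) => //.
- exact: convex_itv.
- by apply: within_cat; apply: within_line; try exact: convex_itv; rewrite /=; lra.
- by apply: within_line; try exact: convex_itv; rewrite /=; lra.
- by move=> s; rewrite /= /cat_fun; case: ifP => _; rewrite ?rv ?rw.
Qed.

(** On an interval that [V] maps into one member of the cover, subdividing
   changes nothing, by multiplicativity. *)
Lemma transport_smallE al a b x y (m : hom (F x) (F y))
    (v : cpath R (set_val x) (set_val y)) (sv : small v) :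
  transport V a b m -> (forall r, a <= r <= b -> U al (V r)) -> runs V a b v ->
  m = sf_hom F sv.
Proof.
move=> tm; elim: tm v sv.
  move=> {m x y a b} a b x y v sv ab rv w sw Vab rw.
  apply: (sf_htp F (al := al)); apply: homotopic_within_eq.
    exact: runs_within rv Vab.
  by move=> s; rewrite rv rw.
move=> {m x y a b} a b c x y z m n tm IHm tn IHn u su Vac ru.
have ab := transport_le tm; have bc := transport_le tn.
have [v rv] := runs_ex (transport_src tm) (transport_tgt tm).
have [w rw] := runs_ex (transport_src tn) (transport_tgt tn).
have Vab r : a <= r <= b -> U al (V r) by move=> ?; apply: Vac; lra.
have Vbc r : b <= r <= c -> U al (V r) by move=> ?; apply: Vac; lra.
have Uv := runs_within ab rv Vab; have Uw := runs_within bc rw Vbc.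
have sv : small v by exists al.
have sw : small w by exists al.
have svw : small (cat_cpath v w) by exists al; exact: within_cat.
rewrite (IHm _ sv)// (IHn _ sw)// -(sf_cat F sv sw svw).
by apply: (sf_htp F (al := al)); exact: runs_cat Vac ru rv rw.
Qed.

Lemma transport_small_ex al a b (x y : B) : a <= b ->
  (forall r, a <= r <= b -> U al (V r)) -> set_val x = V a -> set_val y = V b ->
  exists m : hom (F x) (F y), transport V a b m.
Proof.
move=> ab Vab xa yb; have [v rv] := runs_ex xa yb.
have sv : small v by exists al; exact: runs_within rv Vab.
by exists (sf_hom F sv); exact: transport_small.
Qed.

(** Any subdivision can be refined by an additional point; this makes
   existence and uniqueness of transport additive. *)
Lemma transport_split a b c (x y z : B) (m : hom (F x) (F z)) :
  transport V a c m -> a <= b <= c -> set_val y = V b ->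
  exists (m1 : hom (F x) (F y)) (m2 : hom (F y) (F z)),
    [/\ transport V a b m1, transport V b c m2 & m = gcomp m2 m1].
Proof.
move=> tm; elim: tm b y.
  move=> {m x z a c} a c x z u su ac ru b y /andP[ab bc] yb.
  have [al Uu] := su; have Vac := within_runs ru Uu.
  have [|m1 t1] := @transport_small_ex al a b x y ab _ (runs_src ru) yb.
    by move=> r ?; apply: Vac; lra.
  have [|m2 t2] := @transport_small_ex al b c y z bc _ yb (runs_tgt ru).
    by move=> r ?; apply: Vac; lra.
  exists m1, m2; split=> //; symmetry.
  by apply: transport_smallE Vac ru; exact: transport_cat t1 t2.
move=> {m x z a c} a c e x z t m n tm IHm tn IHn b y /andP[ab be] yb.
have [bc|/ltW cb] := leP b c.
  have [|m1 [m2 [t1 t2 ->]]] := IHm b y _ yb; first by rewrite ab.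
  exists m1, (gcomp n m2); split=> //; first exact: transport_cat t2 tn.
  by rewrite gcompA.
have [|m1 [m2 [t1 t2 ->]]] := IHn b y _ yb; first by rewrite cb.
exists (gcomp m1 m), m2; split=> //; first exact: transport_cat tm t1.
by rewrite gcompA.
Qed.

Lemma transport_unique_ex a b (x : B) : 0 <= a -> a <= b -> b <= 1 ->
  set_val x = V a ->
  exists2 y : B, set_val y = V b & exists! m : hom (F x) (F y), transport V a b m.
Proof.
(* uniqueness is asked on all subintervals so that it can be glued *)
pose Q a b := forall s t (x : B), a <= s -> s <= t -> t <= b -> set_val x = V s ->
  exists2 y : B, set_val y = V t & exists! m : hom (F x) (F y), transport V s t m.
suff Q01 : Q 0 1 by move=> a0 ab b1; exact: Q01.
move=> {a b x}; apply: (@interval_additive R Q)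
  => [a b c _ ab bc _ Qab Qbc s t x|s0 _].
  move=> as_ st tc xs.
  have [tb|/ltW bt] := leP t b; first exact: Qab.
  have [bs|/ltW sb] := leP b s; first exact: Qbc.
  have [y yb [m [tm um]]] := Qab s b x as_ sb (lexx b) xs.
  have [z zt [n [tn un]]] := Qbc b t y (lexx b) bt tc yb.
  exists z => //; exists (gcomp n m); split; first exact: transport_cat tm tn.
  move=> k tk; have [|m' [n' [tm' tn' ->]]] := transport_split tk _ yb.
    by rewrite sb.
  by rewrite (um _ tm') (un _ tn').
have [e e0 [al Ve]] := @locally_in_cover R R^o X A U V Ucov cV s0.
exists e => // a b _ ab _ sa bs s t x as_ st tb xs.
have Vst r : s <= r <= t -> U al (V r).
  by move=> ?; apply: Ve; rewrite /ball/= ltr_norml; lra.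
have [v rv] := runs_ex xs (erefl (V t)).
have sv : small v by exists al; exact: runs_within rv Vst.
have Bt : B (V t) by apply: (Bst sv); exact: set_valP.
exists (SigSub (mem_set Bt)) => //.
exists (@sf_hom _ F x (SigSub (mem_set Bt)) v sv); split.
  exact: transport_small.
by move=> k tk; symmetry; exact: (@transport_smallE al s t x
  (SigSub (mem_set Bt)) k v sv tk Vst rv).
Qed.

Lemma transport_unique a b (x y : B) (m n : hom (F x) (F y)) : 0 <= a -> b <= 1 ->
  transport V a b m -> transport V a b n -> m = n.
Proof.
move=> a0 b1 tm tn; have xa := transport_src tm; have yb := transport_tgt tm.
have [y' y'b [k [_ uk]]] := transport_unique_ex a0 (transport_le tm) b1 xa.
have yy : y' = y by apply: sub_inj; rewrite yb.
by subst y'; rewrite -(uk _ tm) (uk _ tn).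
Qed.

Lemma transport_ex a b (x y : B) : 0 <= a -> a <= b -> b <= 1 ->
  set_val x = V a -> set_val y = V b ->
  exists m : hom (F x) (F y), transport V a b m.
Proof.
move=> a0 ab b1 xa yb; have [y' y'b [m [tm _]]] := transport_unique_ex a0 ab b1 xa.
have yy : y' = y by apply: sub_inj; rewrite yb.
by subst y'; exists m.
Qed.

End along.

Lemma transport_affine (V W : R -> X) (k l a b : R) (x y : B)
    (m : hom (F x) (F y)) : 0 <= k ->
  (forall r, a <= r <= b -> W (k * r + l) = V r) ->
  transport V a b m -> transport W (k * a + l) (k * b + l) m.
Proof.
move=> k0 WV tm; elim: tm WV.
  move=> {m x y a b} a b x y v sv ab rv WV; apply: transport_small; first by nra.
  move=> s; have /andP[s0 s1] := unitI_itv s; rewrite rv -WV; last by nra.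
  by congr W; ring.
move=> {m x y a b} a b c x y z m n tm IHm tn IHn WV.
have ab := transport_le tm; have bc := transport_le tn.
apply: (transport_cat (b := k * b + l)).
  by apply: IHm => r ?; apply: WV; lra.
by apply: IHn => r ?; apply: WV; lra.
Qed.

Section rectangles.
Variable h : R -> R -> X.
Hypothesis ch :
  @cs_continuous (top_cs (R^o * R^o)%type) X (fun p => h p.1 p.2).

Let row (c : R) : R -> X := h^~ c.
Let col (a : R) : R -> X := h a.

Lemma row_continuous c : @cs_continuous (top_cs R) X (row c).
Proof.
apply: (@cs_continuous_comp (top_cs R) (top_cs (R^o * R^o)%type) X
  (fun p => h p.1 p.2) (fun s => (s, c))) ch _.
apply: (@top_cs_continuous R (R^o * R^o)%type) => s.
exact: (@cvg_pair R R^o R^o (nbhs s) (nbhs s) (nbhs c) _ _ _ id (fun=> c)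
  cvg_id (cvg_cst c)).
Qed.

Lemma col_continuous a : @cs_continuous (top_cs R) X (col a).
Proof.
apply: (@cs_continuous_comp (top_cs R) (top_cs (R^o * R^o)%type) X
  (fun p => h p.1 p.2) (fun t => (a, t))) ch _.
apply: (@top_cs_continuous R (R^o * R^o)%type) => s.
exact: (@cvg_pair R R^o R^o (nbhs s) (nbhs a) (nbhs s) _ _ _ (fun=> a) id
  (cvg_cst a) cvg_id).
Qed.

Definition commuting_rectangle (a b c d : R) : Prop :=
  forall (x y z t : B) (m1 : hom (F x) (F y)) (m2 : hom (F y) (F t))
    (n1 : hom (F x) (F z)) (n2 : hom (F z) (F t)),
  transport (row c) a b m1 -> transport (col b) c d m2 ->
  transport (col a) c d n1 -> transport (row d) a b n2 ->
  gcomp m2 m1 = gcomp n2 n1.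

(** Both ways around a rectangle in one member of the cover are homotopic
   inside it, since the rectangle is convex. *)
Lemma rectangle_small al a b c d : a <= b -> c <= d ->
  (forall s t, a <= s <= b -> c <= t <= d -> U al (h s t)) ->
  commuting_rectangle a b c d.
Proof.
move=> ab cd Uh x y z t m1 m2 n1 n2 tm1 tm2 tn1 tn2.
have [v1 rv1] := runs_ex (@row_continuous c) (transport_src tm1) (transport_tgt tm1).
have [v2 rv2] := runs_ex (@col_continuous b) (transport_src tm2) (transport_tgt tm2).
have [w1 rw1] := runs_ex (@col_continuous a) (transport_src tn1) (transport_tgt tn1).
have [w2 rw2] := runs_ex (@row_continuous d) (transport_src tn2) (transport_tgt tn2).
have V1 r : a <= r <= b -> U al (row c r) by move=> ?; apply: Uh; lra.
have V2 r : c <= r <= d -> U al (col b r) by move=> ?; apply: Uh; lra.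
have W1 r : c <= r <= d -> U al (col a r) by move=> ?; apply: Uh; lra.
have W2 r : a <= r <= b -> U al (row d r) by move=> ?; apply: Uh; lra.
have Uv1 := runs_within ab rv1 V1; have Uv2 := runs_within cd rv2 V2.
have Uw1 := runs_within cd rw1 W1; have Uw2 := runs_within ab rw2 W2.
have sv1 : small v1 by exists al.
have sv2 : small v2 by exists al.
have sw1 : small w1 by exists al.
have sw2 : small w2 by exists al.
have sv : small (cat_cpath v1 v2) by exists al; exact: within_cat.
have sw : small (cat_cpath w1 w2) by exists al; exact: within_cat.
rewrite (transport_smallE (@row_continuous c) sv1 tm1 V1 rv1).
rewrite (transport_smallE (@col_continuous b) sv2 tm2 V2 rv2).
rewrite (transport_smallE (@col_continuous a) sw1 tn1 W1 rw1).
rewrite (transport_smallE (@row_continuous d) sw2 tn2 W2 rw2).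
rewrite -(sf_cat F sv1 sv2 sv) -(sf_cat F sw1 sw2 sw); apply: (sf_htp F (al := al)).
pose W := (R^o * R^o)%type.
pose C : set W := [set p | a <= p.1 <= b /\ c <= p.2 <= d].
have cC : convex_set_in C.
  move=> p q r r01 [p1 p2] [q1 q2].
  by split; [apply: (convex_itv r01 p1 q1)|apply: (convex_itv r01 p2 q2)].
have scaleE (u v : R) : u *: (v : R^o) = u * v by [].
apply: (@convex_homotopic R W X (fun p => h p.1 p.2) C (U al) (a, c) (b, d)
  (cat_cpath (@line R W (a, c) (b, c)) (line (b, c) (b, d)))
  (cat_cpath (@line R W (a, c) (a, d)) (line (a, d) (b, d)))) => //.
- by move=> p [p1 p2]; exact: Uh.
- by apply: within_cat; apply: within_line => //; rewrite /C /=; lra.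
- by apply: within_cat; apply: within_line => //; rewrite /C /=; lra.
- by move=> s; rewrite /= /cat_fun; case: ifP => _;
  rewrite ?rv1 ?rv2 /= /row /col !scaleE; congr h; ring.
- by move=> s; rewrite /= /cat_fun; case: ifP => _;
  rewrite ?rw1 ?rw2 /= /row /col !scaleE; congr h; ring.
Qed.

Lemma rectangle_row a b e c d : 0 <= a -> a <= b -> b <= e -> e <= 1 ->
  0 <= c -> c <= d -> d <= 1 ->
  commuting_rectangle a b c d -> commuting_rectangle b e c d ->
  commuting_rectangle a e c d.
Proof.
move=> a0 ab be e1 c0 cd d1 rab rbe x y z t m1 m2 n1 n2 tm1 tm2 tn1 tn2.
have xa := transport_src tm1.
have [|p pb _] := transport_unique_ex (@row_continuous c) a0 ab _ xa; first by lra.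
have [q qd [k [tk _]]] := transport_unique_ex (@col_continuous b) c0 cd d1 pb.
have [|m [m' [tm tm' ->]]] := transport_split (@row_continuous c) tm1 _ pb.
  by rewrite ab.
have [|n [n' [tn tn' ->]]] := transport_split (@row_continuous d) tn2 _ qd.
  by rewrite ab.
by rewrite gcompA (rbe _ _ _ _ _ _ _ _ tm' tm2 tk tn') -!gcompA
  (rab _ _ _ _ _ _ _ _ tm tk tn1 tn).
Qed.

Lemma rectangle_col a b c d e : 0 <= a -> a <= b -> b <= 1 ->
  0 <= c -> c <= d -> d <= e -> e <= 1 ->
  commuting_rectangle a b c d -> commuting_rectangle a b d e ->
  commuting_rectangle a b c e.
Proof.
move=> a0 ab b1 c0 cd de e1 rcd rde x y z t m1 m2 n1 n2 tm1 tm2 tn1 tn2.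
have xa := transport_src tn1.
have [|p pd _] := transport_unique_ex (@col_continuous a) c0 cd _ xa; first by lra.
have [q qb [k [tk _]]] := transport_unique_ex (@row_continuous d) a0 ab b1 pd.
have [|m [m' [tm tm' ->]]] := transport_split (@col_continuous b) tm2 _ qb.
  by rewrite cd.
have [|n [n' [tn tn' ->]]] := transport_split (@col_continuous a) tn1 _ pd.
  by rewrite cd.
by rewrite -gcompA (rcd _ _ _ _ _ _ _ _ tm1 tm tn tk) !gcompA
  (rde _ _ _ _ _ _ _ _ tk tm' tn' tn2).
Qed.

(** Additivity in the vertical direction shows that every vertical line has a
   neighborhood whose strips of full height commute; additivity in the
   horizontal direction then gives the square. *)
Lemma rectangle01 : commuting_rectangle 0 1 0 1.
Proof.
apply: (@interval_additive R (fun a b => commuting_rectangle a b 0 1)).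
  by move=> a b c a0 ab bc c1; apply: rectangle_row => //; lra.
move=> s s01.
(* one width [e] must serve for all heights, which minima provide *)
pose Q c d := exists2 e : R, 0 < e & forall a b, 0 <= a -> a <= b -> b <= 1 ->
  s - e < a -> b < s + e -> commuting_rectangle a b c d.
suff Q01 : Q 0 1 by [].
apply: (@interval_additive R Q).
  move=> c d e c0 cd de e1 [e1' e10 H1] [e2' e20 H2].
  exists (Num.min e1' e2'); first by rewrite lt_min e10.
  move=> a b a0 ab b1 sa bs.
  have m1 : Num.min e1' e2' <= e1' by rewrite ge_min lexx.
  have m2 : Num.min e1' e2' <= e2' by rewrite ge_min lexx orbT.
  by apply: (@rectangle_col a b c d e) => //; [apply: H1|apply: H2] => //; lra.
move=> t _.
have [e e0 [al He]] := locally_in_cover Ucov ch (s, t).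
exists e => // c d _ cd _ tc dt; exists e => // a b _ ab _ sa bs.
apply: (@rectangle_small al) => // s' t' ? ?; apply: (He (s', t')).
by split; rewrite /ball/= ltr_norml; lra.
Qed.

End rectangles.
End transport.
End small_functors.

(** * Extension from a set stable under small paths *)

Section global_extension.
Variables (R : realType) (X : closureSpace) (A : Type) (U : A -> set X).
Variable L : groupoid.
Hypothesis Ucov : interior_cover U.

Lemma small_cst (x : X) : small U (cst_cpath R x).
Proof. by have [al /cs_nbhs_mem Ux] := Ucov x; exists al. Qed.

(** The path made constant outside the unit interval, so that it can be
   subdivided with real parameters. *)
Definition extend_path (x y : X) (v : cpath R x y) (r : R) : X := v (toI r).

Lemma toI_cs_continuous : @cs_continuous (top_cs R) (II R) (@toI R).
Proof. exact: (top_cs_continuous (@toI_continuous R)). Qed.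

Lemma extend_path_continuous x y (v : cpath R x y) :
  @cs_continuous (top_cs R) X (extend_path v).
Proof.
exact: (cs_continuous_comp (@cpath_continuous _ _ _ _ v) toI_cs_continuous).
Qed.

Lemma extend_path_runs x y (v : cpath R x y) : runs (extend_path v) 0 1 v.
Proof. by move=> s; rewrite /extend_path mulr0 add0r mulr1 valIK. Qed.

(** A functor is given here by its action on morphisms only, with the objects
   of [F], so that no equality of objects has to be proved. *)
Definition extends_small_functor (B : set X) (F : small_functor R U L B)
  (G : forall x y : B, path_class R (set_val x) (set_val y) -> hom (F x) (F y)) :=
  [/\ forall x, G x x (class_id R (set_val x)) = gid (F x),
      forall x y z (d : path_class R (set_val y) (set_val z))
        (c : path_class R (set_val x) (set_val y)),
        G x z (class_comp d c) = gcomp (G y z d) (G x y c)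
    & forall x y (v : cpath R (set_val x) (set_val y)) (sv : small U v),
        G x y (cls v) = sf_hom F sv].

Section stable.
Variables (B : set X) (F : small_functor R U L B).
Hypothesis Bst : small_stable R U B.

Section pairs.
Variables x y : B.

Definition path_transport (v : cpath R (set_val x) (set_val y)) m :=
  @transport R X A U L B F (extend_path v) 0 1 x y m.

Lemma path_transport_ex v : exists m, path_transport v m.
Proof.
refine (transport_ex F Bst Ucov (@extend_path_continuous _ _ v) _ _ _ _ _) => //.
- exact: runs_src (@extend_path_runs _ _ v).
- exact: runs_tgt (@extend_path_runs _ _ v).
Qed.

Lemma path_transport_small v (sv : small U v) : path_transport v (sf_hom F sv).
Proof. by apply: transport_small => //; exact: extend_path_runs. Qed.

End pairs.

Lemma path_transport_cat (x y z : B) (v : cpath R (set_val x) (set_val y))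
    (w : cpath R (set_val y) (set_val z)) m n :
  path_transport v m -> path_transport w n ->
  path_transport (cat_cpath v w) (gcomp n m).
Proof.
have catE r : extend_path (cat_cpath v w) r = cat_fun v w (toI r) by [].
move=> tm tn; apply: (transport_cat (b := 2^-1)).
  rewrite (_ : 0 = 2^-1 * 0 + 0); last by ring.
  rewrite [X in transport _ _ X](_ : _ = 2^-1 * 1 + 0); last by ring.
  apply: transport_affine tm => [|r r01]; first by lra.
  rewrite catE /cat_fun /extend_path toIK; last by lra.
  rewrite ifT; last by lra.
  by congr (v _); apply: affIE; rewrite toIK; lra.
rewrite [X in transport _ X](_ : _ = 2^-1 * 0 + 2^-1); last by ring.
rewrite [X in transport _ _ X](_ : _ = 2^-1 * 1 + 2^-1); last by lra.
apply: transport_affine tn => [|r r01]; first by lra.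
rewrite catE /cat_fun /extend_path toIK; last by lra.
case: ifPn => r2; last by congr (w _); apply: affIE; rewrite toIK; lra.
have -> : r = 0 by lra.
rewrite -/(I0 R) cpath0 -[RHS](cpath1 v); congr (v _).
by apply: affIE; rewrite toIK; lra.
Qed.

(** The rectangle of the homotopy commutes and its vertical sides are
   constant. *)
Lemma path_transport_htp (x y : B) (v w : cpath R (set_val x) (set_val y)) m n :
  homotopic v w -> path_transport v m -> path_transport w n -> m = n.
Proof.
move=> [H [cH H0 H1 Hx Hy]] tm tn.
pose h (s t : R) := H (toI s, toI t).
have ch : @cs_continuous (top_cs (R^o * R^o)%type) X (fun p => h p.1 p.2).
  apply: (@cs_continuous_comp (top_cs (R^o * R^o)%type) (prod_cs (II R) (II R)) X
    H (fun p => (toI p.1, toI p.2)) cH).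
  apply: (@cs_continuous_pair (top_cs (R^o * R^o)%type) (II R) (II R)
    (fun p => toI p.1) (fun p => toI p.2)).
    apply: (@top_cs_continuous (R^o * R^o)%type (unitI R)) => p.
    by apply: continuous_comp; [exact: cvg_fst|exact: toI_continuous].
  apply: (@top_cs_continuous (R^o * R^o)%type (unitI R)) => p.
  by apply: continuous_comp; [exact: cvg_snd|exact: toI_continuous].
have row0 : h^~ 0 = extend_path v by apply: funext => s; exact: H0.
have row1 : h^~ 1 = extend_path w by apply: funext => s; exact: H1.
have idc (z : B) (V : R -> X) : (forall r, V r = set_val z) ->
    transport (F := F) V 0 1 (gid (F z)).
  move=> Vz; rewrite -(sf_cst F (small_cst (set_val z))).
  by apply: transport_small => // s; rewrite Vz.
have tx : transport (F := F) (h 0) 0 1 (gid (F x)) by apply: idc => t; exact: Hx.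
have ty : transport (F := F) (h 1) 0 1 (gid (F y)) by apply: idc => t; exact: Hy.
have := @rectangle01 _ _ _ _ _ _ F Bst Ucov h ch x y x y m (gid (F y)) (gid (F x)) n.
by rewrite row0 row1 gcomp1f gcompf1; exact.
Qed.

Lemma stable_small_functor_extends : exists G, @extends_small_functor B F G.
Proof.
pose G (x y : B) (c : path_class R (set_val x) (set_val y)) :=
  projT1 (cid (path_transport_ex (repr c))).
have GP x y c : path_transport (repr c) (G x y c) by rewrite /G; case: cid.
have GE x y (v : cpath R (set_val x) (set_val y)) m :
    path_transport v m -> G x y (cls v) = m.
  move=> tm; exact: (path_transport_htp (repr_cls v) (GP _ _ _) tm).
exists G; split=> [x|x y z d c|x y v sv].
- rewrite (GE _ _ _ _ (path_transport_small (small_cst (set_val x)))).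
  exact: sf_cst.
- rewrite -(cls_repr d) -(cls_repr c) class_compE; apply: GE.
  by apply: path_transport_cat; rewrite cls_repr; exact: GP.
- exact/GE/path_transport_small.
Qed.

End stable.
End global_extension.

(** * Extension from the base points to the points they reach *)

Section reach.
Variables (R : realType) (X : closureSpace) (A : Type) (U : A -> set X).
Variable X0 : set X.
Hypothesis Ucov : interior_cover U.

Definition reach : set X :=
  [set x | exists (p : X0) (d : cpath R x (set_val p)), small U d].

(** The members [U al], [U be], [U ga] may coincide; see
   [cover_reach_triples]. *)
Definition reach_triples : Prop := forall x al be ga, reach x ->
  U al x -> U be x -> U ga x -> exists (p : X0) (d : cpath R x (set_val p)),
    [/\ within (U al) d, within (U be) d & within (U ga) d].

Lemma base_reach (p : X0) : reach (set_val p).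
Proof. by exists p, (cst_cpath R (set_val p)); exact: small_cst. Qed.

Hypothesis triples : reach_triples.

(** A small path from [x] in [U al] is prolonged backwards to [X0] inside the
   same [U al], so its end is joined to [X0] by a path that is again small. *)
Lemma reach_stable : small_stable R U reach.
Proof.
move=> x y v [al Uv] rx; have Ux := within_src Uv.
have [p [d [Ud _ _]]] := triples rx Ux Ux Ux.
exists p, (cat_cpath (rev_cpath v) d), al.
by apply: within_cat => //; exact: within_rev.
Qed.

Section frames.
Variables (L : groupoid) (F : small_functor R U L X0).

(** Values of [F] on small paths from [x] to [X0], where [x] itself need not
   be in [X0]: an object over [x] and compatible morphisms from it. *)
Record frame (x : X) := Frame {
  fr_obj : L;
  fr_hom : forall (p : X0) (e : cpath R x (set_val p)),
    small U e -> hom fr_obj (F p);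
  fr_htp : forall al (p : X0) (e e' : cpath R x (set_val p))
    (se : small U e) (se' : small U e'),
    homotopic_within (U al) e e' -> fr_hom se = fr_hom se';
  fr_cat : forall (p q : X0) (e : cpath R x (set_val p))
    (w : cpath R (set_val p) (set_val q)) (se : small U e) (sw : small U w)
    (sew : small U (cat_cpath e w)),
    fr_hom sew = gcomp (sf_hom F sw) (fr_hom se)
}.

(** The object over [x] is that of the end point [r] of one chosen path [g] in
   [U al]. A path [e] in [U be] has as value that of the reverse of [g]
   followed by [e]. This path need not be small, so it is broken by a path [d]
   to [X0] in both [U al] and [U be]: the value is that of rev g . d, followed by
   that of rev d . e. *)
Section existence.
Variables (x : X) (r : X0) (g : cpath R x (set_val r)) (al : A).
Hypothesis Ug : within (U al) g.

Let rx : reach x. Proof. by exists r, g, al. Qed.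
Let Ux : U al x. Proof. exact: within_src Ug. Qed.

Section value.
Variables (q : X0) (e : cpath R x (set_val q)) (be : A).
Hypothesis Ue : within (U be) e.

Lemma small_bridgel (p : X0) (d : cpath R x (set_val p)) :
  within (U al) d -> small U (cat_cpath (rev_cpath g) d).
Proof. by move=> Ud; exists al; apply: within_cat => //; exact: within_rev. Qed.

Lemma small_bridger (p : X0) (d : cpath R x (set_val p)) :
  within (U be) d -> small U (cat_cpath (rev_cpath d) e).
Proof. by move=> Ud; exists be; apply: within_cat => //; exact: within_rev. Qed.

(** Replacing [d] by [d'] inserts the path rev d . d' and its inverse, once
   evaluated in [U al] and once in [U be]; it lies in both, so the two
   contributions cancel. *)
Lemma bridge_irr (p p' : X0) (d : cpath R x (set_val p))
    (d' : cpath R x (set_val p')) (Ud : within (U al) d) (Vd : within (U be) d)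
    (Ud' : within (U al) d') (Vd' : within (U be) d') :
  gcomp (sf_hom F (small_bridger Vd)) (sf_hom F (small_bridgel Ud)) =
  gcomp (sf_hom F (small_bridger Vd')) (sf_hom F (small_bridgel Ud')).
Proof.
have Uc : within (U al) (cat_cpath (rev_cpath d) d').
  by apply: within_cat => //; exact: within_rev.
have Vc : within (U be) (cat_cpath (rev_cpath d) d').
  by apply: within_cat => //; exact: within_rev.
have sc : small U (cat_cpath (rev_cpath d) d') by exists al.
have s1 : small U (cat_cpath (cat_cpath (rev_cpath d) d') (cat_cpath (rev_cpath d') e)).
  by exists be; apply: within_cat => //; apply: within_cat => //; exact: within_rev.
have s2 : small U (cat_cpath (cat_cpath (rev_cpath g) d) (cat_cpath (rev_cpath d) d')).
  by exists al; apply: within_cat => //; apply: within_cat => //; exact: within_rev.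
have -> : sf_hom F (small_bridger Vd) = sf_hom F s1.
  apply: esym; apply: (sf_htp F (al := be)); apply: homotopic_within_cancel => //.
  exact: within_rev.
have -> : sf_hom F (small_bridgel Ud') = sf_hom F s2.
  apply: esym; apply: (sf_htp F (al := al)); apply: homotopic_within_cancel => //.
  exact: within_rev.
by rewrite (sf_cat F sc (small_bridger Vd')) (sf_cat F (small_bridgel Ud) sc) gcompA.
Qed.

End value.

(** Independence of the member [be] containing [e]: a path [d] inside the
   intersection of [U al] with two such members computes both values. *)
Lemma frame_value_ex (q : X0) (e : cpath R x (set_val q)) : small U e ->
  exists m : hom (F r) (F q), forall be (Ue : within (U be) e) (p : X0)
    (d : cpath R x (set_val p)) (Ud : within (U al) d) (Vd : within (U be) d),
  m = gcomp (sf_hom F (small_bridger Ue Vd)) (sf_hom F (small_bridgel Ud)).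
Proof.
move=> [be Ue].
have [p [d [Ud Vd _]]] := triples rx Ux (within_src Ue) (within_src Ue).
exists (gcomp (sf_hom F (small_bridger Ue Vd)) (sf_hom F (small_bridgel Ud))).
move=> be' Ue' p' d' Ud' Vd'.
have [p'' [d'' [Ud'' Vd'' Vd2]]] :=
  triples rx Ux (within_src Ue) (within_src Ue').
rewrite (bridge_irr Ue Ud Vd Ud'' Vd'') (bridge_irr Ue' Ud' Vd' Ud'' Vd2).
by congr gcomp; exact: sf_irr.
Qed.

Lemma frame_ex : exists _ : frame x, True.
Proof.
pose t (q : X0) (e : cpath R x (set_val q)) (se : small U e) : hom (F r) (F q) :=
  projT1 (cid (frame_value_ex se)).
have tE q e (se : small U e) be (Ue : within (U be) e) (p : X0)
    (d : cpath R x (set_val p)) (Ud : within (U al) d) (Vd : within (U be) d) :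
    t q e se = gcomp (sf_hom F (small_bridger Ue Vd)) (sf_hom F (small_bridgel Ud)).
  by rewrite /t; case: cid => m mE; exact: mE.
have t_htp be (p : X0) (e e' : cpath R x (set_val p)) (se : small U e)
    (se' : small U e') : homotopic_within (U be) e e' -> t p e se = t p e' se'.
  move=> ee'; have [H [[cH H0 H1 _ _] UH]] := ee'.
  have Ue : within (U be) e by move=> s; rewrite -H0.
  have Ue' : within (U be) e' by move=> s; rewrite -H1.
  have [q [d [Ud Vd _]]] := triples rx Ux (within_src Ue) (within_src Ue).
  rewrite (tE _ _ _ _ Ue _ _ Ud Vd) (tE _ _ _ _ Ue' _ _ Ud Vd); congr gcomp.
  apply: (sf_htp F (al := be)); apply: homotopic_within_cat => //.
  by apply: homotopic_within_refl; exact: within_rev.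
unshelve eexists (@Frame x (F r) t t_htp _) => //.
move=> p q e w se sw sew; have [be Uew] := sew.
have Ue := within_catl Uew; have Uw := within_catr Uew.
have [p' [d [Ud Vd _]]] := triples rx Ux (within_src Ue) (within_src Ue).
rewrite (tE _ _ _ _ Ue _ _ Ud Vd) (tE _ _ _ _ Uew _ _ Ud Vd) gcompA; congr gcomp.
have Vr := within_rev Vd.
have s3 : small U (cat_cpath (cat_cpath (rev_cpath d) e) w).
  by exists be; apply: within_cat => //; exact: within_cat.
rewrite -(sf_cat F (small_bridger Ue Vd) sw s3); apply: (sf_htp F (al := be)).
exact: homotopic_within_catA.
Qed.

End existence.

Lemma reach_frame (x : reach) : exists _ : frame (set_val x), True.
Proof.
have [p [d [al Ud]]] : reach (set_val x) := set_valP x.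
exact: frame_ex Ud.
Qed.

Definition frame_at (x : reach) : frame (set_val x) := projT1 (cid (reach_frame x)).

Local Notation O x := (fr_obj (frame_at x)).

Lemma fr_irr (x : reach) (p : X0) (e : cpath R (set_val x) (set_val p))
    (se se' : small U e) : fr_hom (frame_at x) se = fr_hom (frame_at x) se'.
Proof. by congr fr_hom; exact: Prop_irrelevance. Qed.

Section hom_value.
Variables (x y : reach) (v : cpath R (set_val x) (set_val y)).

(** Two paths from [y] to [X0] inside [U al] differ by a small path between
   points of [X0], which contributes the same factor before and after
   composing with [v]. *)
Lemma frame_ratio al (p q : X0) (e : cpath R (set_val y) (set_val p))
    (e' : cpath R (set_val y) (set_val q)) (se : small U e) (se' : small U e')
    (sve : small U (cat_cpath v e)) (sve' : small U (cat_cpath v e')) :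
  within (U al) v -> within (U al) e -> within (U al) e' ->
  gcomp (ginv (fr_hom (frame_at y) se)) (fr_hom (frame_at x) sve) =
  gcomp (ginv (fr_hom (frame_at y) se')) (fr_hom (frame_at x) sve').
Proof.
move=> Uv Ue Ue'; have Ur := within_rev Ue; have Uc := within_cat Ur Ue'.
have sc : small U (cat_cpath (rev_cpath e) e') by exists al.
have s1 : small U (cat_cpath e (cat_cpath (rev_cpath e) e')).
  by exists al; exact: within_cat.
have s2 : small U (cat_cpath (cat_cpath v e) (cat_cpath (rev_cpath e) e')).
  by exists al; apply: within_cat => //; exact: within_cat.
have -> : fr_hom (frame_at y) se' = gcomp (sf_hom F sc) (fr_hom (frame_at y) se).
  rewrite -(fr_cat (frame_at y) se sc s1); apply: esym.
  by apply: (fr_htp _ (al := al)); exact: homotopic_within_catVK.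
have -> : fr_hom (frame_at x) sve' = gcomp (sf_hom F sc) (fr_hom (frame_at x) sve).
  rewrite -(fr_cat (frame_at x) sve sc s2); apply: esym.
  by apply: (fr_htp _ (al := al)); exact: homotopic_within_cancel.
apply: (@gcomp_injl _ _ _ _ (gcomp (sf_hom F sc) (fr_hom (frame_at y) se))).
by rewrite gcompKV -gcompA gcompKV.
Qed.

(** The value of [v] is forced by any path [e] from its end to [X0] for which
   v . e is small. Values forced inside two members [U al] and [U be] are
   compared through a path to [X0] inside both. *)
Lemma frame_hom_ex (sv : small U v) :
  exists m : hom (O x) (O y), forall (p : X0) (e : cpath R (set_val y) (set_val p))
    (se : small U e) (sve : small U (cat_cpath v e)),
  gcomp (fr_hom (frame_at y) se) m = fr_hom (frame_at x) sve.
Proof.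
have [al Uv] := sv; have ry : reach (set_val y) := set_valP y.
have Uy := within_tgt Uv.
have [p [e [Ue _ _]]] := triples ry Uy Uy Uy.
have se : small U e by exists al.
have sve : small U (cat_cpath v e) by exists al; exact: within_cat.
exists (gcomp (ginv (fr_hom (frame_at y) se)) (fr_hom (frame_at x) sve)).
move=> q f sf [be Uvf].
have Vv := within_catl Uvf; have Vf := within_catr Uvf.
have [q' [d [Ud Vd _]]] := triples ry Uy (within_tgt Vv) Uy.
have sd : small U d by exists al.
have svd : small U (cat_cpath v d) by exists al; exact: within_cat.
have svf : small U (cat_cpath v f) by exists be.
rewrite (frame_ratio se sd sve svd Uv Ue Ud).
rewrite (frame_ratio sd sf svd svf Vv Vd Vf) gcompKV.
exact: fr_irr.
Qed.

End hom_value.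

Definition frame_hom (x y : reach) (v : cpath R (set_val x) (set_val y))
  (sv : small U v) : hom (O x) (O y) := projT1 (cid (frame_hom_ex sv)).

Lemma frame_homE (x y : reach) (v : cpath R (set_val x) (set_val y))
    (sv : small U v) (p : X0) (e : cpath R (set_val y) (set_val p))
    (se : small U e) (sve : small U (cat_cpath v e)) :
  gcomp (fr_hom (frame_at y) se) (frame_hom sv) = fr_hom (frame_at x) sve.
Proof. by rewrite /frame_hom; case: cid => m mE; exact: mE. Qed.

Lemma frame_hom_htp al (x y : reach) (v w : cpath R (set_val x) (set_val y))
    (sv : small U v) (sw : small U w) :
  homotopic_within (U al) v w -> frame_hom sv = frame_hom sw.
Proof.
move=> vw; have [H [[cH H0 H1 _ _] UH]] := vw.
have Uv : within (U al) v by move=> s; rewrite -H0.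
have Uw : within (U al) w by move=> s; rewrite -H1.
have Uy := within_tgt Uv; have ry : reach (set_val y) := set_valP y.
have [p [e [Ue _ _]]] := triples ry Uy Uy Uy.
have se : small U e by exists al.
have sve : small U (cat_cpath v e) by exists al; exact: within_cat.
have swe : small U (cat_cpath w e) by exists al; exact: within_cat.
apply: (@gcomp_injl _ _ _ _ (fr_hom (frame_at y) se)).
rewrite (frame_homE sv se sve) (frame_homE sw se swe); apply: (fr_htp _ (al := al)).
by apply: homotopic_within_cat => //; exact: homotopic_within_refl.
Qed.

Lemma frame_hom_cat (x y z : reach) (v : cpath R (set_val x) (set_val y))
    (w : cpath R (set_val y) (set_val z)) (sv : small U v) (sw : small U w)
    (svw : small U (cat_cpath v w)) :
  frame_hom svw = gcomp (frame_hom sw) (frame_hom sv).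
Proof.
have [al Uvw] := svw; have Uv := within_catl Uvw; have Uw := within_catr Uvw.
have Uz := within_tgt Uw; have rz : reach (set_val z) := set_valP z.
have [p [e [Ue _ _]]] := triples rz Uz Uz Uz.
have Uwe := within_cat Uw Ue.
have se : small U e by exists al.
have swe : small U (cat_cpath w e) by exists al.
have s1 : small U (cat_cpath (cat_cpath v w) e) by exists al; exact: within_cat.
have s2 : small U (cat_cpath v (cat_cpath w e)) by exists al; exact: within_cat.
apply: (@gcomp_injl _ _ _ _ (fr_hom (frame_at z) se)).
rewrite gcompA (frame_homE svw se s1) (frame_homE sw se swe) (frame_homE sv swe s2).
apply: esym; apply: (fr_htp _ (al := al)); exact: homotopic_within_catA.
Qed.

Definition reach_functor : small_functor R U L reach :=
  SmallFunctor frame_hom_htp frame_hom_cat.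

Definition base_point (p : X0) : reach := SigSub (mem_set (base_reach p)).

Definition base_hom (p : X0) : hom (O (base_point p)) (F p) :=
  @fr_hom _ (frame_at (base_point p)) p (cst_cpath R (set_val p))
    (small_cst R Ucov (set_val p)).

(** The frame at a point of [X0], evaluated on the constant path, identifies
   the new small functor with [F] on small paths between points of [X0]. *)
Lemma base_hom_natural (p q : X0) (v : cpath R (set_val p) (set_val q))
    (sv : small U v) :
  gcomp (base_hom q) (@frame_hom (base_point p) (base_point q) v sv) =
  gcomp (sf_hom F sv) (base_hom p).
Proof.
have [al Uv] := sv.
have Up := @within_cst R X (U al) _ (within_src Uv).
have Uq := @within_cst R X (U al) _ (within_tgt Uv).
have s1 : small U (cat_cpath v (cst_cpath R (set_val q))).
  by exists al; exact: within_cat.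
have s2 : small U (cat_cpath (cst_cpath R (set_val p)) v).
  by exists al; exact: within_cat.
rewrite (@frame_homE (base_point p) (base_point q) v sv q _ _ s1).
rewrite -(@fr_cat _ (frame_at (base_point p)) p q _ v _ sv s2).
rewrite (@fr_htp _ (frame_at (base_point p)) al q _ _ s1 sv).
  apply: esym; apply: (@fr_htp _ (frame_at (base_point p)) al q) => //.
  exact: homotopic_within_1cat.
exact: homotopic_within_cat1.
Qed.

End frames.

(** Extend to [reach], then to all path classes, and conjugate by the
   identifications [base_hom]. *)
Theorem small_functor_extends (L : groupoid) (F : small_functor R U L X0) :
  exists G, extends_small_functor (F := F) G.
Proof.
have [G [G1 GM GE]] :=
  stable_small_functor_extends Ucov (reach_functor F) reach_stable.
pose b (p : X0) := base_hom F p.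
exists (fun (x y : X0) (c : path_class R (set_val x) (set_val y)) =>
  gcomp (b y) (gcomp (G (base_point x) (base_point y) c) (ginv (b x)))).
split=> [x|x y z d c|x y v sv].
- by rewrite (G1 (base_point x)) gcomp1f gcompfV.
- rewrite (GM (base_point x) (base_point y) (base_point z)).
  by rewrite -!gcompA gcompVK.
- rewrite (GE (base_point x) (base_point y) v sv) /= gcompA.
  by rewrite base_hom_natural -gcompA gcompfV gcompf1.
Qed.

End reach.

(** * The cover and its diagram of groupoids *)

Section cover_hypotheses.
Variables (R : realType) (X : closureSpace) (A : Type) (U : A -> set X).
Variable X0 : set X.

Definition pair_index (al be : A) (i : 'I_2) : A :=
  if val i is 0%N then al else be.

Definition triple_index (al be ga : A) (i : 'I_3) : A :=
  match val i with 0%N => al | 1%N => be | _ => ga end.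

Lemma meets_multi_cap n (nu : 'I_n -> A) x :
  @meets_path_components R (sub_cs (multi_cap U nu)) (set_val @^-1` X0) ->
  (forall i, U (nu i) x) ->
  exists (p : X0) (d : cpath R x (set_val p)), forall i, within (U (nu i)) d.
Proof.
move=> mX0 Ux; have Mx : multi_cap U nu x by move=> i _; exact: Ux.
have [y [[v _] Yy]] := mX0 (sub_point Mx); have X0y : X0 (set_val y) := Yy.
exists (SigSub (mem_set X0y)), (map_cpath (@incl X _) v) => i s.
exact: (set_valP (v s)).
Qed.

(** The hypotheses concern distinct members only. A point of [reach] is joined
   to [X0] in some member; for any other member containing it, either the two
   coincide as sets or the two-fold hypothesis applies. In this way
   repetitions among the three members reduce to fewer members. *)
Lemma cover_reach_triples :
  (forall nu : 'I_2 -> A, injective (fun i => U (nu i)) ->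
    @meets_path_components R (sub_cs (multi_cap U nu)) (set_val @^-1` X0)) ->
  (forall nu : 'I_3 -> A, injective (fun i => U (nu i)) ->
    @meets_path_components R (sub_cs (multi_cap U nu)) (set_val @^-1` X0)) ->
  reach_triples R U X0.
Proof.
move=> X0d X0t.
have dbl x al be : U al x -> U be x -> U al <> U be ->
    exists (p : X0) (d : cpath R x (set_val p)), within (U al) d /\ within (U be) d.
  move=> Ux Vx UV.
  have [|//|p [d Ud]] := @meets_multi_cap 2 (pair_index al be) x.
  - apply: X0d => -[[|[|//]] ?] [[|[|//]] ?]; rewrite /pair_index /= => e;
      apply: val_inj => //=; by case: UV.
  - by move=> [[|[|//]] ?].
  - by exists p, d; split; [exact: (Ud ord0)|exact: (Ud ord_max)].
have one x al : reach R U X0 x -> U al x ->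
    exists (p : X0) (d : cpath R x (set_val p)), within (U al) d.
  move=> [p [d [ze Ud]]] Ux.
  have [UZ|UZ] := pselect (U al = U ze); first by exists p, d; rewrite UZ.
  by have [q [f [Uf _]]] := dbl _ _ _ Ux (within_src Ud) UZ; exists q, f.
have two x al be : reach R U X0 x -> U al x -> U be x ->
    exists (p : X0) (d : cpath R x (set_val p)), within (U al) d /\ within (U be) d.
  move=> rx Ux Vx; have [UV|UV] := pselect (U al = U be); last exact: dbl.
  by have [p [d Ud]] := one _ _ rx Ux; exists p, d; rewrite -UV.
move=> x al be ga rx Ux Vx Wx.
have [UV|UV] := pselect (U al = U be).
  by have [p [d [? ?]]] := two _ _ _ rx Vx Wx; exists p, d; rewrite UV.
have [UW|UW] := pselect (U al = U ga).
  by have [p [d [? ?]]] := two _ _ _ rx Vx Wx; exists p, d; rewrite UW.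
have [VW|VW] := pselect (U be = U ga).
  by have [p [d [? ?]]] := two _ _ _ rx Ux Wx; exists p, d; rewrite VW.
have [|//|p [d Ud]] := @meets_multi_cap 3 (triple_index al be ga) x.
- apply: X0t => -[[|[|[|//]]] ?] [[|[|[|//]]] ?]; rewrite /triple_index /= => e;
    apply: val_inj => //=; by [case: UV|case: UW|case: VW].
- by move=> [[|[|[|//]]] ?].
- exists p, d; split; [exact: (Ud ord0)| |exact: (Ud ord_max)].
  exact: (Ud (@Ordinal 3 1 isT)).
Qed.

End cover_hypotheses.

Section gluing.
Variables (R : realType) (X : closureSpace) (A : Type) (U : A -> set X).
Variable X0 : set X.
Hypothesis Ucov : interior_cover U.

Local Notation PU al := (@PiU R X X0 (U al)).
Local Notation H := (@single_cover R X A U X0).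
Local Notation proj al := (coproj (fun al : A => PU al) al).
Local Notation c := (@single_to_space R X A U X0).

Definition piece_point al (p : X0) (Up : U al (set_val p)) : PU al :=
  SigSub (mem_set (set_valP p : (set_val @^-1` X0) (sub_point Up))).

Section functor_out.
Variables (L : groupoid) (F : functor H L).

Definition piece al : functor (PU al) L := fcomp F (proj al).

Hypothesis eqF : fcomp F (@double_to_single R X A U X0 ord0) =
  fcomp F (@double_to_single R X A U X0 ord_max).

Lemma double_object al be (o : PU al) (o' : PU be) :
  set_val (set_val o) = set_val (set_val o') ->
  exists q : @PiU R X X0 (multi_cap U (pair_index al be)),
    (@PiA_map R _ _ (incl_sub (@multi_cap_sub X A U 2 (pair_index al be) ord0))
         (set_val @^-1` X0) (set_val @^-1` X0) (fun x X0x => X0x)) q = o /\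
    (@PiA_map R _ _ (incl_sub (@multi_cap_sub X A U 2 (pair_index al be) ord_max))
         (set_val @^-1` X0) (set_val @^-1` X0) (fun x X0x => X0x)) q = o'.
Proof.
move=> oo'.
have Mo : multi_cap U (pair_index al be) (set_val (set_val o)).
  move=> -[[|[|//]] ?] _; first exact: (set_valP (set_val o)).
  rewrite oo'; exact: (set_valP (set_val o')).
have X0o : (set_val @^-1` X0) (SigSub (mem_set Mo) : multi_cap U _) := set_valP o.
exists (SigSub (mem_set X0o)); split; apply: sub_inj; apply: sub_inj => //=.
Qed.

Lemma piece_obj_eq al be (o : PU al) (o' : PU be) :
  set_val (set_val o) = set_val (set_val o') -> piece al o = piece be o'.
Proof.
move=> /double_object[q [<- <-]].
exact: (@functor_eq_obj _ _ _ _
  (existT _ (pair_index al be) q : @double_cover R X A U X0) eqF).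
Qed.

(** The coequalizing condition, evaluated at the path in the two-fold
   intersection from which both [w] and [w'] come. *)
Lemma piece_hom_eq al be (o1 o2 : PU al) (o1' o2' : PU be)
    (w : cpath R (set_val o1) (set_val o2))
    (w' : cpath R (set_val o1') (set_val o2'))
    (e1 : piece al o1 = piece be o1') (e2 : piece al o2 = piece be o2') :
  (forall s, set_val (w s) = set_val (w' s)) ->
  gcomp (idto e2) (@fhom _ _ (piece al) o1 o2 (cls w)) =
  gcomp (@fhom _ _ (piece be) o1' o2' (cls w')) (idto e1).
Proof.
move=> ww'.
have h1 : set_val (set_val o1) = set_val (set_val o1').
  by have := ww' (I0 R); rewrite !cpath0.
have h2 : set_val (set_val o2) = set_val (set_val o2').
  by have := ww' (I1 R); rewrite !cpath1.
have [q1 [E1 E1']] := double_object h1; have [q2 [E2 E2']] := double_object h2.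
subst o1 o1' o2 o2'.
have Mw s : multi_cap U (pair_index al be) (set_val (w s)).
  move=> -[[|[|//]] ?] _; first exact: (set_valP (w s)).
  rewrite ww'; exact: (set_valP (w' s)).
pose v := map_cpath (@incl X _) w.
pose u := @lift_cpath R X (multi_cap U (pair_index al be)) (set_val q1) (set_val q2)
  v Mw.
pose f : hom (existT _ (pair_index al be) q1 : @double_cover R X A U X0)
    (existT _ (pair_index al be) q2) := existT _ erefl (cls u).
have := @functor_eq_hom _ _ (fcomp F (@double_to_single R X A U X0 ord0))
  (fcomp F (@double_to_single R X A U X0 ord_max)) _ _ f e1 e2 eqF.
rewrite /= /cotuple_hom /= /fcomp_hom /= /fcomp_hom /=.
rewrite !class_mapE.
set u0 := map_cpath _ u; set u1 := map_cpath _ u.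
have -> : cls u0 = cls w by apply/clsP/eq_homotopic => s; exact: sub_inj.
have -> // : cls u1 = cls w'.
by apply/clsP/eq_homotopic => s; apply: sub_inj; rewrite -ww'.
Qed.

End functor_out.
End gluing.

(** * Existence of the factorization *)

Section factorization.
Variables (R : realType) (X : closureSpace) (A : Type) (U : A -> set X).
Variable X0 : set X.
Hypothesis Ucov : interior_cover U.
Variables (L : groupoid) (F : functor (@single_cover R X A U X0) L).
Hypothesis eqF : fcomp F (@double_to_single R X A U X0 ord0) =
  fcomp F (@double_to_single R X A U X0 ord_max).

Local Notation PU al := (@PiU R X X0 (U al)).
Local Notation c := (@single_to_space R X A U X0).

Definition cover_index (p : X0) : A := projT1 (cid (Ucov (set_val p))).

Lemma cover_indexP p : U (cover_index p) (set_val p).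
Proof. by rewrite /cover_index; case: cid => al Ual; exact: cs_nbhs_mem Ual. Qed.

(** The choice of a member of the cover is immaterial by [piece_glued]. *)
Definition glued_obj (p : X0) : L :=
  piece F (cover_index p) (piece_point R (cover_indexP p)).

Lemma piece_glued al (o : PU al) (p : X0) :
  set_val (set_val o) = set_val p -> piece F al o = glued_obj p.
Proof. by move=> op; apply: (@piece_obj_eq R X A U X0 L F eqF). Qed.

(** A small path is evaluated in a member containing it; by [piece_hom_eq] the
   result, transported to the objects [glued_obj], is the same for all such
   members. *)
Lemma glued_hom_ex (p q : X0) (v : cpath R (set_val p) (set_val q)) : small U v ->
  exists m : hom (glued_obj p) (glued_obj q),
  forall al (o1 o2 : PU al) (w : cpath R (set_val o1) (set_val o2))
    (e1 : piece F al o1 = glued_obj p) (e2 : piece F al o2 = glued_obj q),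
  (forall s, set_val (w s) = v s) ->
  gcomp (idto e2) (@fhom _ _ (piece F al) o1 o2 (cls w)) = gcomp m (idto e1).
Proof.
move=> [al Uv]; have Up := within_src Uv; have Uq := within_tgt Uv.
pose o1 := piece_point R Up; pose o2 := piece_point R Uq.
pose w := @lift_cpath R X (U al) (set_val o1) (set_val o2) v Uv.
have E1 : piece F al o1 = glued_obj p by exact: piece_glued.
have E2 : piece F al o2 = glued_obj q by exact: piece_glued.
exists (gcomp (idto E2) (gcomp (@fhom _ _ (piece F al) o1 o2 (cls w)) (idto (esym E1)))).
move=> be o1' o2' w' e1 e2 w'v.
have E1' : piece F be o1' = piece F al o1 by rewrite e1.
have E2' : piece F be o2' = piece F al o2 by rewrite e2.
have ww' s : set_val (w' s) = set_val (w s) by rewrite w'v.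
rewrite -(idto_trans E2' E2 e2) -gcompA.
rewrite (@piece_hom_eq R X A U X0 L F eqF be al o1' o2' o1 o2 w' w E1' E2' ww').
by rewrite -!gcompA (idto_trans e1 (esym E1) E1').
Qed.

Definition glued_hom (p q : X0) (v : cpath R (set_val p) (set_val q))
  (sv : small U v) : hom (glued_obj p) (glued_obj q) :=
  projT1 (cid (glued_hom_ex sv)).

Lemma glued_homE (p q : X0) (v : cpath R (set_val p) (set_val q)) (sv : small U v)
    al (o1 o2 : PU al) (w : cpath R (set_val o1) (set_val o2))
    (e1 : piece F al o1 = glued_obj p) (e2 : piece F al o2 = glued_obj q) :
  (forall s, set_val (w s) = v s) ->
  gcomp (idto e2) (@fhom _ _ (piece F al) o1 o2 (cls w)) =
  gcomp (glued_hom sv) (idto e1).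
Proof. by rewrite /glued_hom; case: cid => m mE; exact: mE. Qed.

Lemma glued_hom_within al (p q : X0) (Up : U al (set_val p)) (Uq : U al (set_val q))
    (v : cpath R (set_val p) (set_val q)) (Uv : within (U al) v) (sv : small U v)
    (e1 : piece F al (piece_point R Up) = glued_obj p)
    (e2 : piece F al (piece_point R Uq) = glued_obj q) :
  gcomp (idto e2)
    (@fhom _ _ (piece F al) (piece_point R Up) (piece_point R Uq)
       (class_within Up Uq Uv)) =
  gcomp (glued_hom sv) (idto e1).
Proof. by apply: glued_homE. Qed.

Lemma glued_hom_htp al (p q : X0) (v w : cpath R (set_val p) (set_val q))
    (sv : small U v) (sw : small U w) :
  homotopic_within (U al) v w -> glued_hom sv = glued_hom sw.
Proof.
move=> vw; have [H [[cH H0 H1 _ _] UH]] := vw.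
have Uv : within (U al) v by move=> s; rewrite -H0.
have Uw : within (U al) w by move=> s; rewrite -H1.
have Up := within_src Uv; have Uq := within_tgt Uv.
have e1 : piece F al (piece_point R Up) = glued_obj p by exact: piece_glued.
have e2 : piece F al (piece_point R Uq) = glued_obj q by exact: piece_glued.
apply: (gcomp_injr (h := idto e1)).
rewrite -(glued_hom_within Uv sv e1 e2) -(glued_hom_within Uw sw e1 e2).
by congr (gcomp _ (fhom _ _)); apply/class_within_eq.
Qed.

Lemma glued_hom_cat (p q r : X0) (v : cpath R (set_val p) (set_val q))
    (w : cpath R (set_val q) (set_val r)) (sv : small U v) (sw : small U w)
    (svw : small U (cat_cpath v w)) :
  glued_hom svw = gcomp (glued_hom sw) (glued_hom sv).
Proof.
have [al Uvw] := svw; have Uv := within_catl Uvw; have Uw := within_catr Uvw.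
have Up := within_src Uv; have Uq := within_src Uw; have Ur := within_tgt Uw.
have e1 : piece F al (piece_point R Up) = glued_obj p by exact: piece_glued.
have e2 : piece F al (piece_point R Uq) = glued_obj q by exact: piece_glued.
have e3 : piece F al (piece_point R Ur) = glued_obj r by exact: piece_glued.
apply: (gcomp_injr (h := idto e1)).
rewrite -(glued_hom_within Uvw svw e1 e3) (class_within_cat Up Uq Ur Uv Uw Uvw).
have -> : @fhom _ _ (piece F al) (piece_point R Up) (piece_point R Ur)
    (gcomp (class_within Uq Ur Uw) (class_within Up Uq Uv)) =
  gcomp (@fhom _ _ (piece F al) (piece_point R Uq) (piece_point R Ur) (class_within Uq Ur Uw))
    (@fhom _ _ (piece F al) (piece_point R Up) (piece_point R Uq) (class_within Up Uq Uv)).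
  exact: (@fhomM _ _ (piece F al) (piece_point R Up) (piece_point R Uq) (piece_point R Ur)).
by rewrite gcompA (glued_hom_within Uw sw e2 e3) -gcompA (glued_hom_within Uv sv e1 e2) gcompA.
Qed.

Definition glued_functor : small_functor R U L X0 :=
  SmallFunctor glued_hom_htp glued_hom_cat.

Hypothesis triples : reach_triples R U X0.

Lemma factorization_ex : exists G : functor (@PiA R X X0) L, fcomp G c = F.
Proof.
have [G [G1 GM GE]] := small_functor_extends Ucov triples glued_functor.
pose G' := @Functor (@PiA R X X0) L glued_obj G G1 GM.
have eo : forall o, fcomp G' c o = F o.
  by move=> [al o]; symmetry; exact: (@piece_glued al o (c (existT _ al o))).
exists G'; apply: (functor_ext (e := eo)) => -[al o1] [be o2] [/= e f].
case: be / e o2 f => o2 f; rewrite -(cls_repr f).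
set w := repr f.
have sw : small U (map_cpath (@incl X (U al)) w).
  by exists al => s; exact: (set_valP (w s)).
have := GE (c (existT _ al o1)) (c (existT _ al o2)) _ sw.
rewrite /fcomp_hom /= class_mapE => ->.
have h := esym (@glued_homE (c (existT _ al o1)) (c (existT _ al o2)) _ sw al o1 o2 w
  (esym (eo (existT _ al o1))) (esym (eo (existT _ al o2))) (fun=> erefl)).
apply: (gcomp_injl (h := idto (esym (eo (existT _ al o2))))).
rewrite gcompA (idto_trans _ _ erefl) idto_id gcomp1f gcompA.
apply: (gcomp_injr (h := idto (esym (eo (existT _ al o1))))).
by rewrite -[RHS]gcompA (idto_trans _ _ erefl) idto_id gcompf1; exact: h.
Qed.

End factorization.

(** * Uniqueness of the factorization *)

Lemma within_homotopic (R : realType) (X : closureSpace) (S : set X) (x y : X)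
    (v w : cpath R x y) : homotopic_within S v w -> homotopic v w.
Proof. by move=> [H [h _]]; exists H. Qed.

Section uniqueness.
Variables (R : realType) (X : closureSpace) (A : Type) (U : A -> set X).
Variable X0 : set X.
Hypothesis Ucov : interior_cover U.
Hypothesis triples : reach_triples R U X0.

Local Notation c := (@single_to_space R X A U X0).
Local Notation PX := (Pi R X).

Variables (L : groupoid) (G G' : functor (@PiA R X X0) L).
Hypothesis GG' : fcomp G c = fcomp G' c.

Lemma piece_lift al (p : X0) : U al (set_val p) ->
  exists o : @PiU R X X0 (U al), c (existT _ al o) = p.
Proof. by move=> Up; exists (piece_point R Up); exact: sub_inj. Qed.

Lemma functors_eq_obj (p : X0) : G p = G' p.
Proof.
have [al Ual] := Ucov (set_val p); have [o <-] := piece_lift (cs_nbhs_mem Ual).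
exact: (@functor_eq_obj _ _ _ _ (existT _ al o : @single_cover R X A U X0) GG').
Qed.

Definition agree (p q : X0) (d : @hom PX (set_val p) (set_val q)) : Prop :=
  gcomp (idto (functors_eq_obj q)) (@fhom _ _ G p q d) =
  gcomp (@fhom _ _ G' p q d) (idto (functors_eq_obj p)).

Lemma agree_comp (p q r : X0) (d : @hom PX (set_val p) (set_val q))
    (d' : @hom PX (set_val q) (set_val r)) :
  agree d -> agree d' -> agree (gcomp d' d).
Proof.
move=> ad ad'; rewrite /agree.
rewrite (@fhomM _ _ G p q r d' d) (@fhomM _ _ G' p q r d' d).
by rewrite gcompA ad' -gcompA ad gcompA.
Qed.

Lemma agree_small (p q : X0) (v : cpath R (set_val p) (set_val q)) :
  small U v -> agree (cls v).
Proof.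
move=> [al Uv].
have [o1 E1] := piece_lift (within_src Uv).
have [o2 E2] := piece_lift (within_tgt Uv).
subst p q.
pose w := @lift_cpath R X (U al) (set_val o1) (set_val o2) v Uv.
have -> : cls v = class_map (@incl X (U al)) (cls w).
  by rewrite class_mapE; apply/clsP/eq_homotopic.
exact: (@functor_eq_hom _ _ (fcomp G c) (fcomp G' c) (existT _ al o1)
  (existT _ al o2) (existT _ erefl (cls w))).
Qed.

(** The end points of a piece of a path need not be in [X0], so [G] and [G']
   are compared after closing the piece up by small paths. *)
Definition agree_around (x y : X) (d : @hom PX x y) : Prop :=
  forall (p q : X0) (g : cpath R (set_val p) x) (e : cpath R y (set_val q)),
  small U g -> small U e -> agree (@gcomp PX _ _ _ (cls e) (gcomp d (cls g))).

Lemma small_rev (x y : X) (v : cpath R x y) : small U v -> small U (rev_cpath v).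
Proof. by move=> [al Uv]; exists al; exact: within_rev. Qed.

(** A small path [f] from the intermediate point to [X0] and its reverse are
   inserted between the two pieces. *)
Lemma agree_around_comp (x y z : X) (d : @hom PX x y) (d' : @hom PX y z) :
  reach R U X0 y -> agree_around d -> agree_around d' ->
  agree_around (gcomp d' d).
Proof.
move=> [r [f sf]] ad ad' p q g e sg se.
have -> : gcomp (cls e : @hom PX _ _) (gcomp (gcomp d' d) (cls g)) =
    gcomp (gcomp (cls e : @hom PX _ _) (gcomp d' (cls (rev_cpath f))))
      (gcomp (cls f : @hom PX _ _) (gcomp d (cls g))).
  rewrite -class_invE -!gcompA; congr gcomp; congr gcomp.
  by rewrite [X in _ = gcomp X _]/(ginv (cls f : @hom PX y (set_val r))) gcompVK.
by apply: agree_comp; [exact: ad|apply: ad' => //; exact: small_rev].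
Qed.

(** The closed-up path need not be small. It becomes a composite of three
   small paths after inserting a path [d] to [X0] inside both [U be] and
   [U al] at its first corner, and a path [f] inside both [U ga] and [U al] at
   its second one. *)
Lemma agree_around_small (x y : X) (v : cpath R x y) :
  small U v -> agree_around (cls v).
Proof.
move=> [al Uv] p q g e [be Ug] [ga Ue].
have rx : reach R U X0 x.
  by exists p, (rev_cpath g), be; exact: within_rev.
have ry : reach R U X0 y by exists q, e, ga.
have Ux := within_src Uv; have Uy := within_tgt Uv.
have [r [d [Ud Vd _]]] := triples rx Ux (within_tgt Ug) Ux.
have [t [f [Uf Vf _]]] := triples ry Uy (within_src Ue) Uy.
pose m1 := cat_cpath g d.
pose m2 := cat_cpath (rev_cpath d) (cat_cpath v f).
pose m3 := cat_cpath (rev_cpath f) e.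
pose D : @hom PX x (set_val r) := cls d.
pose E : @hom PX y (set_val t) := cls f.
have m1E : cls m1 = gcomp D (cls g) by rewrite /= class_compE.
have m2E : cls m2 = gcomp (gcomp E (cls v)) (ginv D).
  by rewrite /= class_invE /E (class_compE v f) class_compE.
have m3E : cls m3 = gcomp (cls e : @hom PX _ _) (ginv E).
  by rewrite /= class_invE /E class_compE.
have -> : gcomp (cls e : @hom PX _ _) (gcomp (cls v : @hom PX _ _) (cls g)) =
    gcomp (cls m3 : @hom PX _ _) (gcomp (cls m2 : @hom PX _ _) (cls m1)).
  by rewrite m1E m2E m3E -!gcompA !gcompVK.
apply: agree_comp; last first.
  by apply: agree_small; exists ga; apply: within_cat => //; exact: within_rev.
apply: agree_comp; apply: agree_small.
  by exists be; exact: within_cat.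
exists al; apply: within_cat; first exact: within_rev.
exact: within_cat.
Qed.

Lemma functors_eq : G = G'.
Proof.
apply: (@functor_ext _ _ G G' functors_eq_obj) => p q d.
pose v := repr (d : path_class R (set_val p) (set_val q)).
have <- : cls v = d by exact: cls_repr.
have cV := @extend_path_continuous R X _ _ v.
(* [reach] is propagated along the path together with agreement *)
pose Q a b := forall x y (w : cpath R x y), runs (extend_path v) a b w ->
  reach R U X0 x -> reach R U X0 y /\ agree_around (cls w).
have [_ av] : reach R U X0 (set_val q) /\ agree_around (cls v).
- suff Q01 : Q 0 1 by apply: Q01; [exact: extend_path_runs|exact: base_reach].
  apply: (@interval_additive R Q) => [a b c a0 ab bc c1 Qab Qbc x z u ru rx|s s01].
    have [v1 r1] := runs_ex cV (runs_src ru) (erefl (extend_path v b)).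
    have [v2 r2] := runs_ex cV (erefl (extend_path v b)) (runs_tgt ru).
    have [ry a1] := Qab _ _ _ r1 rx; have [rz a2] := Qbc _ _ _ r2 ry.
    split=> //.
    have <- : gcomp (cls v2 : @hom PX _ _) (cls v1) = cls u.
      rewrite /= class_compE; apply/clsP/(@within_homotopic _ _ setT).
      by apply: (runs_cat cV ab bc _ ru r1 r2).
    exact: agree_around_comp.
  have [e e0 [al He]] := @locally_in_cover R R^o X A U _ Ucov cV s.
  exists e => // a b _ ab _ sa bs x y w rw rx.
  have sw : small U w.
    exists al; apply: (runs_within ab rw) => r rab; apply: He.
    by rewrite /ball/= ltr_norml; lra.
  by split; [exact: reach_stable sw rx|exact: agree_around_small].
have := av p q _ _ (small_cst R Ucov (set_val p)) (small_cst R Ucov (set_val q)).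
by rewrite /agree /= class_comp1f class_compf1.
Qed.

End uniqueness.

(** * The coequalizer *)

Lemma PiA_idto_cls (R : realType) (X : closureSpace) (X0 : set X)
    (p q p' q' : @PiA R X X0) (v : cpath R (set_val p) (set_val q))
    (v' : cpath R (set_val p') (set_val q')) (ep : p = p') (eq : q = q') :
  (forall s, v s = v' s) ->
  gcomp (idto eq) (cls v : @hom (@PiA R X X0) p q) =
  gcomp (cls v' : @hom (@PiA R X X0) p' q') (idto ep).
Proof.
move=> vv'; subst p' q'; rewrite !idto_id gcomp1f gcompf1.
by apply/clsP/eq_homotopic.
Qed.

Theorem theorem4p12 (R : realType) (X : closureSpace) (A : Type)
    (U : A -> set X) (X0 : set X)
    (Ucover : interior_cover U)
    (X0_double : forall nu : 'I_2 -> A, injective (fun i => U (nu i)) ->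
      @meets_path_components R (sub_cs (multi_cap U nu)) (set_val @^-1` X0))
    (X0_triple : forall nu : 'I_3 -> A, injective (fun i => U (nu i)) ->
      @meets_path_components R (sub_cs (multi_cap U nu)) (set_val @^-1` X0)) :
  is_coequalizer
    (@double_to_single R X A U X0 ord0)
    (@double_to_single R X A U X0 ord_max)
    (@single_to_space R X A U X0).
Proof.
have triples := cover_reach_triples X0_double X0_triple.
split.
  have e nu : fcomp (@single_to_space R X A U X0) (@double_to_single R X A U X0 ord0) nu
     = fcomp (@single_to_space R X A U X0) (@double_to_single R X A U X0 ord_max) nu.
    by case: nu => nu o; exact: sub_inj.
  apply: (functor_ext (e := e)) => -[nu o1] [nu' o2] [/= E f].
  case: nu' / E o2 f => o2 f.
  rewrite -(cls_repr f) /= /fcomp_hom /= !class_mapE.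
  exact: PiA_idto_cls.
move=> L F eqF; have [G GF] := factorization_ex Ucover eqF triples.
exists G; split=> // G' G'F.
by apply: (functors_eq Ucover triples); rewrite GF G'F.
Qed.
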